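(* Let $(G,G')$ be an irreducible real reductive dual pair with $G$ compact, and let $\Pi\otimes\Pi'$ be an irreducible representation of $\widetilde G\times\widetilde{G'}$ occurring in Howe's correspondence. Then the (unique up to a non-zero constant multiple) non-zero symmetry breaking operator in $$\mathrm{Hom}_{\widetilde G\widetilde{G'}}(\mathcal H_\omega^\infty,\mathcal H_\Pi^\infty\otimes\mathcal H_{\Pi'}^\infty)$$ is not a differential operator.
   Context: The irreducible dual pairs with $G$ compact are, up to isomorphism, $(\mathrm O_d,\mathrm{Sp}_{2m}(\mathbb R))$, $(\mathrm U_d,\mathrm U_{p,q})$, $(\mathrm{Sp}_d,\mathrm O^*_{2m})$, acting on a real symplectic space $(W,\langle\cdot,\cdot\rangle)$. Fix $\chi(r)=e^{2\pi ir}$, a compatible positive complex structure $J$ on $W$ (i.e. $J\in\mathfrak{sp}(W)$, $J^2=-1$, $\langle J\cdot,\cdot\rangle>0$) commuting with $G$ and contained in $G'$, and a complete polarization $W=X\oplus Y$ with $J(X)=Y$. $(\omega,\mathcal H_\omega)$ is the Weil representation of the metaplectic group $\widetilde{\mathrm{Sp}}(W)$ attached to $\chi$, in the Schrödinger model $\mathcal H_\omega=L^2(X)$, with smooth vectors $\mathcal H_\omega^\infty=\mathcal S(X)$. $\widetilde G,\widetilde{G'}$ are the preimages of $G,G'$ in $\widetilde{\mathrm{Sp}}(W)$. A pair of irreducible representations $\Pi$ of $\widetilde G$ and $\Pi'$ of $\widetilde{G'}$ occurs in Howe's correspondence if $\Pi\otimes\Pi'$ is a quotient of $\omega^\infty$;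 then, by Howe, $\dim\mathrm{Hom}_{\widetilde G\widetilde{G'}}(\mathcal H_\omega^\infty,\mathcal H_\Pi^\infty\otimes\mathcal H_{\Pi'}^\infty)=1$. $\Pi\otimes\Pi'$ is realized as a subspace of $\mathcal S'(X)$, so that $\mathrm{Hom}_{\widetilde G\widetilde{G'}}(\mathcal H_\omega^\infty,\mathcal H_\Pi^\infty\otimes\mathcal H_{\Pi'}^\infty)\subseteq\mathrm{Hom}(\mathcal S(X),\mathcal S'(X))$; since $G$ is compact, up to a constant the operator is the orthogonal projection of $L^2(X)$ onto the $\Pi$-isotypic component of $\omega|_{\widetilde G}$ (restricted to $\mathcal S(X)$). A continuous linear operator $\mathcal S(X)\to\mathcal S'(X)$ is a differential operator (with distribution coefficients) if its Schwartz kernel in $\mathcal S'(X\times X)$ is supported on the diagonal $\{(x,x):x\in X\}$. *)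

(* Defs.v *)
From HB Require Import structures.
From mathcomp Require Import all_boot all_order all_algebra.
From mathcomp Require Import all_classical all_reals all_analysis.
From mathcomp Require Import complex.

Set Implicit Arguments.
Unset Strict Implicit.
Unset Printing Implicit Defensive.

Import Order.TTheory GRing.Theory Num.Theory numFieldNormedType.Exports.

Local Open Scope ring_scope.
Local Open Scope complex_scope.
Local Open Scope classical_set_scope.

Notation cabs := ComplexField.Normc.normc.

Section Schwartz.
Variables (R : realType) (n : nat).
Implicit Types (f g : 'cV[R]_n -> R[i]) (s : seq 'I_n).

Definition re_fun f : 'cV[R]_n -> R := fun x => complex.Re (f x).
Definition im_fun f : 'cV[R]_n -> R := fun x => complex.Im (f x).

Definition pderiv (i : 'I_n) f : 'cV[R]_n -> R[i] := fun x =>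
  ('D_(delta_mx i ord0) (re_fun f) x) +i* ('D_(delta_mx i ord0) (im_fun f) x).

Definition pderivs s f := foldr pderiv f s.

Definition is_schwartz f := forall s,
  (forall x, differentiable (re_fun (pderivs s f)) x /\
             differentiable (im_fun (pderivs s f)) x) /\
  (forall k : nat, exists C : R, forall x,
     (1 + `|x|) ^+ k * cabs (pderivs s f x) <= C).

Definition schwartz_pred : {pred ('cV[R]_n -> R[i])} :=
  [pred f | `[< is_schwartz f >]].

Let smooth f := forall s x, differentiable (re_fun (pderivs s f)) x /\
                            differentiable (im_fun (pderivs s f)) x.

Let derivableT (h : 'cV[R]_n -> R) x v : differentiable h x -> derivable h x v.
Proof. exact: diff_derivable. Qed.

Arguments derivableT : clear implicits.

Let re_comb (a : R[i]) f g : re_fun (a *: f + g) =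
  complex.Re a *: re_fun f + (- complex.Im a) *: im_fun f + re_fun g.
Proof.
apply/funext => y; rewrite /re_fun /im_fun !fctE; case: a => a1 a2.
by case: (f y) => u1 u2; case: (g y) => v1 v2 /=; rewrite /GRing.scale /= mulNr.
Qed.

Let im_comb (a : R[i]) f g : im_fun (a *: f + g) =
  complex.Re a *: im_fun f + complex.Im a *: re_fun f + im_fun g.
Proof.
apply/funext => y; rewrite /re_fun /im_fun !fctE; case: a => a1 a2.
by case: (f y) => u1 u2; case: (g y) => v1 v2 /=; rewrite /GRing.scale /=.
Qed.

Let derive_comb (p q : R) (u v w : 'cV[R]_n -> R) x e :
  differentiable u x -> differentiable v x -> differentiable w x ->
  'D_e (p *: u + q *: v + w) x = p * 'D_e u x + q * 'D_e v x + 'D_e w x.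
Proof.
move=> /(derivableT _ _ e) du /(derivableT _ _ e) dv /(derivableT _ _ e) dw.
have dpu := derivableZ (k := p) du; have dqv := derivableZ (k := q) dv.
rewrite (deriveD (derivableD dpu dqv) dw) (deriveD dpu dqv).
by rewrite (deriveZ p du) (deriveZ q dv).
Qed.

Let differentiable_comb (p q : R) (u v w : 'cV[R]_n -> R) x :
  differentiable u x -> differentiable v x -> differentiable w x ->
  differentiable (p *: u + q *: v + w) x.
Proof.
move=> du dv dw.
have dpu := differentiableZ p du; have dqv := differentiableZ q dv.
exact: (differentiableD (differentiableD dpu dqv) dw).
Qed.

Let re_conj f : re_fun (fun x => (f x)^*) = re_fun f.
Proof. by apply/funext => y; rewrite /re_fun; case: (f y). Qed.

Let im_conj f : im_fun (fun x => (f x)^*) = - im_fun f.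
Proof. by apply/funext => y; rewrite /im_fun fctE; case: (f y). Qed.

Let pderivs_comb (a : R[i]) f g : smooth f -> smooth g ->
  forall s, pderivs s (a *: f + g) = a *: pderivs s f + pderivs s g.
Proof.
move=> sf sg; elim=> [//|i s IH] /=; rewrite IH; apply/funext => x.
have [frx fix_] := sf s x; have [grx gix] := sg s x.
rewrite /pderiv re_comb im_comb !derive_comb// !fctE.
by case: a {IH} => a1 a2; rewrite /GRing.scale /= mulNr.
Qed.

Let pderivs_conj f : smooth f ->
  forall s, pderivs s (fun x => (f x)^*) = (fun x => (pderivs s f x)^*).
Proof.
move=> sf; elim=> [//|i s IH] /=; rewrite IH; apply/funext => x.
have [_ fix_] := sf s x; rewrite /pderiv re_conj im_conj deriveN//.
exact: (derivableT _ _ _ fix_).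
Qed.

Lemma schwartz_submod_closed : submod_closed schwartz_pred.
Proof.
have zero s : pderivs s (0 : 'cV[R]_n -> R[i]) = 0.
  elim: s => [//|i s IH] /=; rewrite IH; apply/funext => x.
  have -> : pderiv i 0 x = ('D_(delta_mx i ord0) (cst 0 : 'cV[R]_n -> R) x)
    +i* ('D_(delta_mx i ord0) (cst 0 : 'cV[R]_n -> R) x) by [].
  by rewrite !derive_cst.
split.
  apply/asboolP => s; rewrite zero; split=> [x|k].
    by split; exact: differentiable_cst.
  by exists 0 => x; rewrite ComplexField.Normc.normc0 mulr0.
move=> a f g /asboolP sf /asboolP sg; apply/asboolP => s.
have smf : smooth f by move=> s' x; exact: (sf s').1.
have smg : smooth g by move=> s' x; exact: (sg s').1.
rewrite pderivs_comb//; split=> [x|k].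
  have [frx fix_] := smf s x; have [grx gix] := smg s x.
  rewrite re_comb im_comb; split;
    exact: differentiable_comb.
have [Cf hf] := (sf s).2 k; have [Cg hg] := (sg s).2 k.
exists (cabs a * Cf + Cg) => x; rewrite !fctE.
have p0 : 0 <= (1 + `|x|) ^+ k by rewrite exprn_ge0// addr_ge0.
apply: le_trans (ler_wpM2l p0 (le_normcD _ _)) _.
rewrite mulrDr lerD// ComplexField.Normc.normcM mulrCA ler_wpM2l//.
by case: (a) => u v; exact: sqrtr_ge0.
Qed.

Lemma schwartz_conj f : f \in schwartz_pred ->
  (fun x => (f x)^*) \in schwartz_pred.
Proof.
move=> /asboolP sf; apply/asboolP => s.
have smf : smooth f by move=> s' x; exact: (sf s').1.
rewrite pderivs_conj//; split=> [x|k].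
  have [frx fix_] := smf s x; rewrite re_conj im_conj; split=> //.
  exact: differentiableN.
have [C hC] := (sf s).2 k; exists C => x.
suff -> : cabs (pderivs s f x)^* = cabs (pderivs s f x) by exact: hC.
by case: (pderivs s f x) => u v /=; rewrite sqrrN.
Qed.

HB.instance Definition _ :=
  GRing.isSubmodClosed.Build _ _ schwartz_pred schwartz_submod_closed.

Record schwartz : Type := Schwartz {
  schwartz_fun :> 'cV[R]_n -> R[i];
  schwartz_funP : schwartz_fun \in schwartz_pred }.

HB.instance Definition _ := [isSub for schwartz_fun].
HB.instance Definition _ := [Choice of schwartz by <:].
HB.instance Definition _ := [SubChoice_isSubLmodule of schwartz by <:].

Definition sconj (f : schwartz) : schwartz :=
  Schwartz (schwartz_conj (schwartz_funP f)).

(* The seminorms sn k m, for k and m in nat, define the Frechet topology of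
   the Schwartz space; as sn k m is nondecreasing in k and m, a linear map
   into a seminormed space is continuous iff its seminorm is bounded by a
   multiple of one sn k m. *)
Definition sn (k m : nat) (f : schwartz) : R :=
  sup [set r | exists s x, (size s <= m)%N /\
                 r = (1 + `|x|) ^+ k * cabs (pderivs s f x)].

Definition tempered (u : schwartz -> R[i]) :=
  scalar u /\ exists k m C, forall f : schwartz, cabs (u f) <= C * sn k m f.

Definition schwartz_supp (f : schwartz) : set 'cV[R]_n :=
  closure [set x | f x != 0].

(* supp u `<=` D, for a closed set D *)
Definition supported_in (u : schwartz -> R[i]) (D : set 'cV[R]_n) :=
  forall f : schwartz, compact (schwartz_supp f) ->
    schwartz_supp f `&` D = set0 -> u f = 0.

End Schwartz.
Arguments schwartz : clear implicits.

Section SchwartzKernel.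
Variables (R : realType) (N : nat).

(* A : S(X) -> S'(X), with A phi psi the value at psi of the distribution
   A phi.  The kernel K in S'(X x X) is characterized by
   K (psi (x) phi) = A phi psi, and it is unique. *)
Definition differential_operator (A : schwartz R N -> schwartz R N -> R[i]) :=
  exists K : schwartz R (N + N) -> R[i],
    [/\ tempered K,
        (forall (phi psi : schwartz R N) (theta : schwartz R (N + N)),
           (forall x x', theta (col_mx x x') = psi x * phi x') ->
           K theta = A phi psi) &
        supported_in K (range (fun x : 'cV[R]_N => col_mx x x))].

End SchwartzKernel.

Section L2.
Variable R : realType.

(* The Lebesgue integral over R^n as an iterated integral. *)
Fixpoint integral_n (n : nat) : ('cV[R]_n -> R) -> R :=
  match n with
  | 0 => fun f => f 0
  | n'.+1 => fun f =>
      Rintegral (@lebesgue_measure R) setT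
        (fun t => integral_n (fun x : 'cV[R]_n' =>
           f (col_mx (t%:M : 'cV[R]_1) x)))
  end.

Definition l2sq (n : nat) (f : schwartz R n) : R :=
  integral_n (fun x => cabs (f x) ^+ 2).

End L2.

Section Symplectic.
Variables (R : realType) (N : nat).
Local Notation W := 'cV[R]_(N + N).
Local Notation MW := 'M[R]_(N + N).

(* A complete polarization W = X (+) Y identifies Y with the dual of X.  A
   basis of X and the dual basis of Y identify X and Y with R^N, and the
   symplectic form with <(x,y), (x',y')> = x . y' - y . x'. *)
Definition inX (x : 'cV[R]_N) : W := col_mx x 0.
Definition inY (y : 'cV[R]_N) : W := col_mx 0 y.

Definition sform (w w' : W) : R :=
  (w^T *m block_mx 0 1%:M (- 1%:M) 0 *m w') ord0 ord0.

Definition Sp : set MW :=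
  [set g | forall w w', sform (g *m w) (g *m w') = sform w w'].

Definition centralizer_in_Sp (A : set MW) : set MW :=
  [set g | Sp g /\ forall h, A h -> g *m h = h *m g].

Definition stable (A : set MW) (U : {vspace W}) :=
  forall g u, A g -> u \in U -> g *m u \in U.

Definition acts_reductively (A : set MW) :=
  forall U, stable A U -> exists U', [/\ stable A U', (U + U')%VS = fullv &
    (U :&: U')%VS = 0%VS].

Definition irreducible_dual_pair (G G' : set MW) :=
  [/\ (0 < N)%N,
      G' = centralizer_in_Sp G,
      G = centralizer_in_Sp G',
      acts_reductively G /\ acts_reductively G' &
      forall U U' : {vspace W},
        stable G U -> stable G' U -> stable G U' -> stable G' U' ->
        (U + U')%VS = fullv -> (U :&: U')%VS = 0%VS ->
        (forall u u', u \in U -> u' \in U' -> sform u u' = 0) ->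
        U = 0%VS \/ U' = 0%VS].

Definition compatible_structure (G G' : set MW) (J : MW) :=
  [/\ (forall w w', sform (J *m w) w' + sform w (J *m w') = 0),
      J *m J = - 1%:M,
      (forall w, w != 0 -> 0 < sform (J *m w) w),
      (forall g, G g -> J *m g = g *m J) /\ G' J &
      (mulmx J) @` range inX = range inY].

End Symplectic.

Section Metaplectic.
Variables (R : realType) (N : nat).
Local Notation W := 'cV[R]_(N + N).
Local Notation MW := 'M[R]_(N + N).
Local Notation SX := (schwartz R N).

Definition chi (r : R) : R[i] := cos (2 * pi * r) +i* sin (2 * pi * r).

(* The Schroedinger representation of the Heisenberg group W x R, with product
   (w,r)(w',r') = (w + w', r + r' + <w,w'>/2) and central character chi, at the
   element (w, 0), w = x0 + y0:
   f |-> (x |-> chi (<y0,x> - <y0,x0>/2) f (x - x0)). *)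
Definition heis (w : W) (f : 'cV[R]_N -> R[i]) : 'cV[R]_N -> R[i] := fun x =>
  let x0 := usubmx w in
  let y0 := dsubmx w in
  chi (sform (inY y0) (inX x) - 2^-1 * sform (inY y0) (inX x0)) * f (x - x0).

(* A pair (g, U); the operator U is given by its restriction to S(X), which
   every unitary operator of L^2(X) implementing an element of Sp(W)
   preserves, S(X) being the space of smooth vectors of the Heisenberg group. *)
Definition mpelt : Type := (MW * (SX -> SX))%type.

Definition mp1 : mpelt := (1%:M, id).
Definition mpM (p q : mpelt) : mpelt := (p.1 *m q.1, p.2 \o q.2).

(* U is unitary and U rho(w) U^-1 = rho(g w) for the Schroedinger
   representation rho. *)
Definition implements (p : mpelt) :=
  [/\ Sp p.1,
      linear p.2,
      bijective p.2,
      (forall f, l2sq (p.2 f) = l2sq f) &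
      forall w (f h : SX), (h : _ -> _) = heis w f ->
        (p.2 h : _ -> _) = heis (p.1 *m w) (p.2 f)].

(* By Stone-von Neumann the pairs (g, U) as above form an extension of Sp(W)
   by the circle.  As Sp(W) is perfect, it contains exactly one subgroup that
   is a double cover of Sp(W): this is the metaplectic group, and the Weil
   representation is omega (g, U) = U. *)
Definition metaplectic_group (Mp : set mpelt) :=
  [/\ (forall p, Mp p -> implements p),
      Mp mp1 /\ (forall p q, Mp p -> Mp q -> Mp (mpM p q)),
      (forall p, Mp p -> exists q, [/\ Mp q, mpM p q = mp1 & mpM q p = mp1]),
      (forall g, Sp g -> exists2 p, Mp p & p.1 = g) &
      forall p, (Mp p /\ p.1 = 1%:M) <-> (p = mp1 \/ p = (1%:M, -%R))].

Definition mp_preimage (Mp : set mpelt) (A : set MW) : set mpelt :=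
  [set p | Mp p /\ A p.1].

(* Basic neighbourhoods of p, for the topology of Sp(W) on the first component
   and the strong operator topology of L^2(X) on the second one. *)
Definition mp_near (p : mpelt) (e : R) (s : seq SX) (q : mpelt) :=
  `|q.1 - p.1| < e /\ forall f, f \in s -> l2sq (q.2 f - p.2 f) < e.

Definition mp_continuous (K : set mpelt) (E : topologicalType)
    (F : mpelt -> E) :=
  forall p, K p -> forall V, nbhs (F p) V ->
    exists e s, 0 < e /\ forall q, K q -> mp_near p e s q -> V (F q).

End Metaplectic.

Section Representations.
Variables (R : realType) (N : nat) (K : set (mpelt R N)).
Variables (E : normedModType R[i]) (pi : mpelt R N -> E -> E).

Definition representation :=
  [/\ (forall p, K p -> linear (pi p) /\ continuous (pi p)),
      pi (mp1 R N) = id,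
      (forall p q, K p -> K q -> pi (mpM p q) = pi p \o pi q) &
      forall v, mp_continuous K (fun p => pi p v)].

Definition irreducible_rep :=
  (exists v : E, v != 0) /\
  forall A : set E, closed A -> A 0 ->
    (forall (a : R[i]) u v, A u -> A v -> A (a *: u + v)) ->
    (forall p v, K p -> A v -> A (pi p v)) ->
    A = [set 0] \/ A = setT.

Record one_param : Type := OneParam {
  op_fun :> R -> mpelt R N;
  op_in : forall t, K (op_fun t);
  op_add : forall s t, op_fun (s + t) = mpM (op_fun s) (op_fun t);
  op_cont : forall t0 e (s : seq (schwartz R N)), 0 < e ->
    \forall t \near t0, mp_near (op_fun t0) e s (op_fun t) }.

Definition quot (c : one_param) (v : E) : R -> E :=
  fun t => (t^-1)%:C *: (pi (c t) v - v).

(* The action of the Lie algebra of K, an element of which is given by its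
   one-parameter subgroup. *)
Definition dpi (c : one_param) (v : E) : E := lim (quot c v @ 0^').

(* v is smooth iff dpi c1 (dpi c2 (... v)) exists for all c1, c2, ...; for a
   continuous representation on a Banach space these are the vectors with a
   C^oo orbit map. *)
Fixpoint smooth_upto (k : nat) (v : E) : Prop :=
  if k is k'.+1 then
    forall c : one_param, cvg (quot c v @ 0^') /\ smooth_upto k' (dpi c v)
  else True.

Definition smooth_vector (v : E) := forall k, smooth_upto k v.

(* The seminorms v |-> `|dpis cs v| define the topology of the space of smooth
   vectors. *)
Definition dpis (cs : seq one_param) (v : E) : E := foldr dpi v cs.

End Representations.

Definition hilbert_norm (R : realType) (H : normedModType R[i]) :=
  forall u v : H,
    `|u + v| ^+ 2 + `|u - v| ^+ 2 = 2 * `|u| ^+ 2 + 2 * `|v| ^+ 2.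

Section Howe.
Variables (R : realType) (N : nat) (Gt Gt' : set (mpelt R N)).
(* Gt is meant to be compact: its irreducible representations are finite
   dimensional, and Pi is given by matrices. *)
Variables (d : nat) (Pi : mpelt R N -> 'M[R[i]]_d).
Variables (H : completeNormedModType R[i]) (Pi' : mpelt R N -> H -> H).
Local Notation SX := (schwartz R N).
(* C^d (x) H, the family v standing for \sum_i e_i (x) v i *)
Local Notation T := ('I_d -> H).

Definition act1 (p : mpelt R N) (v : T) : T :=
  fun i => \sum_j Pi p i j *: v j.
Definition act2 (q : mpelt R N) (v : T) : T := fun i => Pi' q (v i).

(* Every vector of C^d is smooth, so that this is the space of smooth vectors
   of Pi tensored with that of Pi'. *)
Definition smooth_tensor (v : T) := forall i, smooth_vector Gt' Pi' (v i).

Definition intertwining (Q : SX -> T) :=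
  [/\ linear Q,
      (forall f, smooth_tensor (Q f)),
      (forall (cs : seq (one_param Gt')) i, exists k m C, forall f : SX,
         `|dpis Pi' cs (Q f i)| <= (C * sn k m f)%:C),
      (forall p f, Gt p -> Q (p.2 f) = act1 p (Q f)) &
      (forall q f, Gt' q -> Q (q.2 f) = act2 q (Q f))].

Definition occurs_in_Howe :=
  exists Q, intertwining Q /\
    forall v, smooth_tensor v -> exists f, Q f = v.

(* An equivariant embedding of the tensor product of the spaces of smooth
   vectors into S'(X).  The group acts on S'(X) by the extension of omega from
   S(X), embedded by f |-> (phi |-> \int f phi):
   (omega(g) u)(conj (omega(g) (conj phi))) = u phi. *)
Definition realization (iota : T -> SX -> R[i]) :=
  [/\ [/\ (forall v, smooth_tensor v -> tempered (iota v)),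
          (forall (a : R[i]) u v phi, smooth_tensor u -> smooth_tensor v ->
             iota (a *: u + v) phi = a * iota u phi + iota v phi) &
          (forall v, smooth_tensor v -> iota v = (fun=> 0) -> v = 0)],
      (forall phi, exists (L : seq (seq (one_param Gt'))) (C : R),
         forall v, smooth_tensor v ->
           `|iota v phi| <= C%:C * \sum_(cs <- L) \sum_i `|dpis Pi' cs (v i)|),
      (forall p v phi, Gt p -> smooth_tensor v ->
         iota (act1 p v) (sconj (p.2 (sconj phi))) = iota v phi) &
      (forall q v phi, Gt' q -> smooth_tensor v ->
         iota (act2 q v) (sconj (q.2 (sconj phi))) = iota v phi)].

End Howe.

(* Main.v *)
(* Let D (f, phi) be the value at phi of the distribution A f, where A is the
   operator, and let (J, U_J) be a lift of J to the metaplectic group.  The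
   square of (J, U_J) lies over -1, and it commutes with the preimage of G, as
   commutation up to sign holds already for (J, U_J).  By Schur's lemma it acts
   by a scalar on Pi, so A f and A (U_J^2 f) are proportional.  But U_J^2
   reflects supports in the origin, as it inverts the characters of X.  If A is
   local, A f is therefore supported on the hyperplane x_i = 0: cut f into a
   piece living far from phi and one which the reflection moves far from phi.
   This holds for all f, and A commutes with U_J.  Being of finite order, A f is
   killed by a high power of 1 - cos (w x_i).  Conjugation by U_J, an abstract
   Fourier transform, turns this into the statement that A f is killed by a high
   power of a difference operator psi (x - t u) - psi x, where u_i > 0 since J is
   positive.  For psi in a slab and t large, all terms but psi live away from the
   hyperplane, hence A f kills psi, and A = 0. *)
Require Import Defs.
From HB Require Import structures.
From mathcomp Require Import all_boot all_order all_algebra.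
From mathcomp Require Import all_classical all_reals all_analysis.
From mathcomp Require Import complex ring lra.
Import Order.TTheory GRing.Theory Num.Theory numFieldNormedType.Exports.
Local Open Scope ring_scope.
Local Open Scope complex_scope.
Local Open Scope classical_set_scope.
Set Implicit Arguments.
Unset Strict Implicit.
Unset Printing Implicit Defensive.

(** * Functions of one real variable with bounded derivatives *)

Section BoundedDerivatives.
Variable R : realType.
Implicit Types (f g h : R -> R) (A B c x : R) (m : nat).

(** One constant [A] bounds [h] and its derivatives up to order [m]. Carrying the derivative as a
    witness joins differentiability to the bound and makes induction on [m] available. *)
Fixpoint bC m A h : Prop :=
  (forall x, `|h x| <= A) /\
  if m is m'.+1 then exists h', (forall x, is_derive x 1 h (h' x)) /\ bC m' A h'
  else True.

Definition smooth_bounded h := forall m, exists A, bC m A h.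

Lemma bC_norm m A h x : bC m A h -> `|h x| <= A.
Proof. by case: m => [|m] []. Qed.

Lemma bC_ge0 m A h : bC m A h -> 0 <= A.
Proof. by move=> /(bC_norm 0); exact: le_trans. Qed.

Lemma bC_le m A B h : A <= B -> bC m A h -> bC m B h.
Proof.
move=> AB; elim: m h => [|m IH] h [hA].
  by move=> _; split=> // x; exact: le_trans (hA x) AB.
case=> h' [dh bh]; split=> [x|]; first exact: le_trans (hA x) AB.
by exists h'; split=> //; exact: IH.
Qed.

Lemma bCS m A h : bC m.+1 A h -> bC m A h.
Proof.
elim: m h => [|m IH] h; first by case=> hA.
by case=> hA [h' [dh bh]]; split=> //; exists h'; split=> //; exact: IH.
Qed.

Lemma bC_cst m c : bC m `|c| (fun=> c).
Proof.
suff E B : `|c| <= B -> bC m B (fun=> c) by exact: E.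
elim: m c => [|m IH] c cB; split=> //.
exists (fun=> 0); split; first by move=> x; exact: is_derive_cst.
by apply: IH; rewrite normr0 (le_trans _ cB).
Qed.

Lemma bCD m A B f g : bC m A f -> bC m B g -> bC m (A + B) (fun x => f x + g x).
Proof.
elim: m f g => [|m IH] f g [fA Hf] [gB Hg].
  by split=> // x; exact: le_trans (ler_normD _ _) (lerD _ _).
split=> [x|]; first exact: le_trans (ler_normD _ _) (lerD _ _).
case: Hf => f' [df bf]; case: Hg => g' [dg bg].
exists (fun x => f' x + g' x); split; last exact: IH.
by move=> x; have := is_deriveD (df x) (dg x).
Qed.

Lemma is_derive_mul f g (f' g' : R) x : is_derive x 1 f f' ->
  is_derive x 1 g g' -> is_derive x 1 (fun y => f y * g y) (f' * g x + f x * g').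
Proof.
move=> df dg; have := is_deriveM df dg.
by rewrite addrC /GRing.scale /= (mulrC (g x)).
Qed.

(** By the Leibniz rule each differentiation doubles the number of terms, whence [2 ^+ m]. *)
Lemma bCM m A B f g : bC m A f -> bC m B g ->
  bC m (2 ^+ m * (A * B)) (fun x => f x * g x).
Proof.
elim: m f g => [|m IH] f g Hf Hg.
  rewrite expr0 mul1r; split=> // x; rewrite normrM.
  by apply: ler_pM => //; [case: Hf|case: Hg].
have AB0 : 0 <= A * B by rewrite mulr_ge0 ?(bC_ge0 Hf) ?(bC_ge0 Hg).
case: (Hf) => fA [f' [df bf]]; case: (Hg) => gB [g' [dg bg]]; split=> [x|].
  rewrite normrM; apply: le_trans (ler_pM _ _ (fA x) (gB x)) _ => //.
  by rewrite ler_peMl// exprn_ege1// ler1n.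
exists (fun x => f' x * g x + f x * g' x); split.
  by move=> x; exact: is_derive_mul.
rewrite exprS -mulrA mulr_natl mulr2n.
by apply: bCD; apply: IH => //; exact: bCS.
Qed.

Lemma bCN m A f : bC m A f -> bC m A (fun x => - f x).
Proof.
elim: m f => [|m IH] f [fA Hf]; first by split=> // x; rewrite normrN.
split=> [x|]; first by rewrite normrN.
case: Hf => f' [df bf]; exists (fun x => - f' x); split; last exact: IH.
by move=> x; have := is_deriveN (df x).
Qed.

Lemma bCZ m A c f : bC m A f -> bC m (`|c| * A) (fun x => c * f x).
Proof.
elim: m f => [|m IH] f [fA Hf].
  by split=> // x; rewrite normrM ler_wpM2l.
split=> [x|]; first by rewrite normrM ler_wpM2l.
case: Hf => f' [df bf]; exists (fun x => c * f' x); split; last exact: IH.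
by move=> x; have := is_deriveZ c (df x).
Qed.

Lemma is_derive_affine f (f' c e x : R) : is_derive (c * x + e) 1 f f' ->
  is_derive x 1 (fun y => f (c * y + e)) (c * f').
Proof.
move=> df; have dl : is_derive x 1 (fun y : R => c * y + e) c.
  have := is_deriveD (is_deriveZ c (is_derive_id x (1 : R))) (is_derive_cst e x 1).
  by rewrite addr0 /GRing.scale /= mulr1.
have := @is_derive1_comp R f (fun y => c * y + e) x f' c df dl.
by rewrite mulrC.
Qed.

(** Each differentiation brings out a factor [c]; since [1 <= K], the worst case is [K ^+ m]. *)
Lemma bC_affine m A K c e h : 1 <= K -> `|c| <= K ->
  bC m A h -> bC m (A * K ^+ m) (fun x => h (c * x + e)).
Proof.
move=> K1 cK; elim: m h => [|m IH] h Hh.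
  by rewrite expr0 mulr1; split=> // x; exact: bC_norm Hh.
have A0 := bC_ge0 Hh; have K0 : 0 <= K by rewrite (le_trans _ K1).
case: Hh => hA [h' [dh bh]]; split=> [x|].
  by rewrite (le_trans (hA _))// ler_peMr// exprn_ege1.
exists (fun x => c * h' (c * x + e)); split.
  by move=> x; exact: is_derive_affine.
apply: bC_le (bCZ c (IH _ bh)).
by rewrite exprS (mulrCA A K) ler_wpM2r// mulr_ge0// exprn_ge0.
Qed.

Lemma bC_ext m A f g : f =1 g -> bC m A f -> bC m A g.
Proof. by move=> /funext ->. Qed.

Lemma bC_sin_cos m c : bC m 1 (fun x => sin (x + c)) /\ bC m 1 (fun x => cos (x + c)).
Proof.
have sh (f : R -> R) (f' x : R) : is_derive (x + c) 1 f f' ->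
    is_derive x 1 (fun y => f (y + c)) f'.
  move=> df; have := @is_derive_affine f f' 1 c x.
  rewrite mul1r => /(_ df); rewrite mul1r.
  by under eq_fun do rewrite mul1r.
elim: m => [|m [IHs IHc]].
  by split; split=> // x; [exact: sin_max|exact: cos_max].
split; split=> [x|]; rewrite ?sin_max ?cos_max//.
  exists (fun x => cos (x + c)); split=> // x; apply: sh; exact: is_derive_sin.
exists (fun x => - sin (x + c)); split; last exact: bCN.
by move=> x; apply: sh; exact: is_derive_cos.
Qed.

(** The derivative [- h' / h ^ 2] involves [1 / h] only to order [m], so the bound climbs one order
    at a time. *)
Lemma bC_inv m A d h : 0 < d -> (forall x, d <= h x) -> bC m A h ->
  exists B, bC m B (fun x => (h x)^-1).
Proof.
move=> d0 dh; have h0 x : 0 < h x := lt_le_trans d0 (dh x).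
have hV x : `|(h x)^-1| <= d^-1.
  by rewrite ger0_norm ?invr_ge0 ?(ltW (h0 x))// lef_pV2// posrE.
elim: m => [|m IH] Hh; first by exists d^-1; split.
have [B HB] := IH (bCS Hh); case: Hh => hA [h' [dh' bh']].
have Hd : bC m (2 ^+ m * (A * (2 ^+ m * (B * B))))
    (fun x => - (h' x * ((h x)^-1 * (h x)^-1))).
  by apply: bCN; apply: bCM => //; exact: bCM.
exists (Num.max d^-1 (2 ^+ m * (A * (2 ^+ m * (B * B))))); split=> [x|].
  by rewrite le_max hV.
exists (fun x => - (h' x * ((h x)^-1 * (h x)^-1))); split.
  move=> x; have := is_deriveV (lt0r_neq0 (h0 x)) (dh' x).
  move=> /is_derive_eq; apply.
  by rewrite /GRing.scale /= mulNr mulrC -invfM -expr2.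
by apply: bC_le Hd; rewrite le_max lexx orbT.
Qed.

Lemma sbM f g : smooth_bounded f -> smooth_bounded g ->
  smooth_bounded (fun x => f x * g x).
Proof.
move=> Hf Hg m; have [A fA] := Hf m; have [B gB] := Hg m.
by exists (2 ^+ m * (A * B)); exact: bCM.
Qed.

Lemma sbD f g : smooth_bounded f -> smooth_bounded g ->
  smooth_bounded (fun x => f x + g x).
Proof.
move=> Hf Hg m; have [A fA] := Hf m; have [B gB] := Hg m.
by exists (A + B); exact: bCD.
Qed.

Lemma sbN f : smooth_bounded f -> smooth_bounded (fun x => - f x).
Proof. by move=> Hf m; have [A fA] := Hf m; exists A; exact: bCN. Qed.

Lemma sb_cst c : smooth_bounded (fun=> c).
Proof. by move=> m; exists `|c|; exact: bC_cst. Qed.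

Lemma sbB f g : smooth_bounded f -> smooth_bounded g ->
  smooth_bounded (fun x => f x - g x).
Proof. by move=> Hf Hg; apply: sbD => //; exact: sbN. Qed.

Lemma sbX n f : smooth_bounded f -> smooth_bounded (fun x => f x ^+ n).
Proof.
move=> Hf; elim: n => [|n IH].
  by have -> : (fun x => f x ^+ 0) = fun=> 1 by []; exact: sb_cst.
have -> : (fun x => f x ^+ n.+1) = fun x => f x * f x ^+ n.
  by apply/funext => x; rewrite exprS.
exact: sbM.
Qed.

Lemma sb_affine c e f : smooth_bounded f -> smooth_bounded (fun x => f (c * x + e)).
Proof.
move=> Hf m; have [A fA] := Hf m; exists (A * (Num.max 1 `|c|) ^+ m).
by apply: bC_affine fA; rewrite le_max lexx ?orbT.
Qed.

Lemma sb_inv d f : 0 < d -> (forall x, d <= f x) -> smooth_bounded f ->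
  smooth_bounded (fun x => (f x)^-1).
Proof. by move=> d0 df Hf m; have [A fA] := Hf m; exact: (bC_inv d0 df fA). Qed.

Lemma sb_sin : smooth_bounded sin.
Proof.
move=> m; exists 1; have [+ _] := bC_sin_cos m 0.
by apply: bC_ext => x; rewrite addr0.
Qed.

Lemma sb_cos : smooth_bounded cos.
Proof.
move=> m; exists 1; have [_ +] := bC_sin_cos m 0.
by apply: bC_ext => x; rewrite addr0.
Qed.

End BoundedDerivatives.

(** * Smooth step and bump functions *)

Section StepFunction.
Variable R : realType.
Implicit Types (x : R).

(** The classical flat function [exp (- 1 / x)] multiplied by powers of [1 / x]: the linear span of
    this family is closed under differentiation. *)
Definition flat (k : nat) (x : R) : R :=
  if 0 < x then x^-1 ^+ k * expR (- x^-1) else 0.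

Lemma flat_le0 k x : x <= 0 -> flat k x = 0.
Proof. by rewrite /flat ltNge => ->. Qed.

Lemma flat_ge0 k x : 0 <= flat k x.
Proof.
rewrite /flat; case: ifP => // x0.
by rewrite mulr_ge0 ?expR_ge0// exprn_ge0// invr_ge0 ltW.
Qed.

(** With [y = 1 / x], the exponential series gives [y ^ k / k! <= exp y]. *)
Lemma flat_bounded k x : `|flat k x| <= k`!%:R.
Proof.
rewrite ger0_norm ?flat_ge0// /flat; case: ifP => [x0|_]; last exact: ler0n.
rewrite expRN ler_pdivrMr ?expR_gt0//.
have y0 : 0 <= x^-1 by rewrite invr_ge0 ltW.
case: k => [|k]; first by rewrite expr0 fact0 mul1r (le_trans _ (expR_ge1Dx _))// lerDl.
have := expR_ge1Dxn k y0; rewrite -ler_pdivrMl ?ltr0n ?fact_gt0// mulrC.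
by apply: le_trans; rewrite lerDr.
Qed.

Lemma flatS k x : flat k x = flat k.+1 x * x.
Proof.
rewrite /flat; case: ifP => x0; last by rewrite mul0r.
by rewrite exprS; field; rewrite gt_eqF.
Qed.

Lemma is_derive_flat k x :
  is_derive x 1 (flat k) (- k%:R * flat k.+1 x + flat k.+2 x).
Proof.
have [x0|x0|->] := ltgtP x 0.
- rewrite !flat_le0 ?(ltW x0)// mulr0 addr0.
  apply: (near_eq_is_derive _ (is_derive_cst 0 x 1)); near=> y.
  by rewrite /cst flat_le0// ltW//; near: y; exact: lt_nbhsl.
- have D : is_derive x 1 (fun y : R => y^-1 ^+ k * expR (- y^-1))
    (- k%:R * flat k.+1 x + flat k.+2 x).
    have dV : is_derive x 1 (fun y : R => y^-1) (- x ^- 2).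
      have := is_deriveV (lt0r_neq0 x0) (is_derive_id x (1:R)).
      by move=> /is_derive_eq; apply; rewrite /GRing.scale /= mulr1.
    have dE : is_derive x 1 (fun y : R => expR (- y^-1)) (expR (- x^-1) * x ^- 2).
      have dN := is_deriveN dV; rewrite opprK in dN.
      exact: (@is_derive1_comp R expR (fun y => - y^-1) x _ _ (is_derive_expR _) dN).
    have dX : is_derive x 1 (fun y : R => y^-1 ^+ k)
        (k%:R * x^-1 ^+ k.-1 * - x ^- 2).
      have -> : (fun y : R => y^-1 ^+ k) = (fun y : R => y^-1) ^+ k.
        by apply/funext => y; rewrite exprfctE.
      exact: is_deriveX.
    apply: is_derive_eq (is_derive_mul dX dE) _.
    have -> : x ^- 2 = x^-1 * x^-1 by rewrite -exprVn expr2.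
    rewrite /flat x0; set y := x^-1; set e := expR _.
    case: k {dX} => [|k]; first by rewrite !expr0; ring.
    by rewrite /= !exprS; ring.
  apply: (near_eq_is_derive _ D); near=> y.
  by rewrite /flat ifT//; near: y; exact: lt_nbhsr.
- rewrite !flat_le0// mulr0 addr0.
  (* At [0] the difference quotient of [flat k] is [flat k.+1], which tends to [0] because it is [x]
     times the bounded function [flat k.+2]. *)
  apply/is_derive1_caratheodory; exists (flat k.+1); split.
  + by move=> z; rewrite (flat_le0 k (lexx 0)) !subr0 flatS.
  + have c0 : flat k.+1 y @[y --> (0 : R)] --> (0 : R).
      apply/cvgr0Pnorm_lt => e e0.
      have d0 : 0 < e / (k.+2)`!%:R by rewrite divr_gt0// ltr0n fact_gt0.
      apply: filterS (nbhs0_lt (V := R) d0) => z hz.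
      rewrite flatS normrM (le_lt_trans (ler_wpM2r _ (flat_bounded _ _)))//.
      rewrite mulrC -ltr_pdivlMr ?ltr0n ?fact_gt0//.
    by move: c0; rewrite -[X in _ --> X -> _](flat_le0 k.+1 (lexx 0)).
  + by rewrite flat_le0.
Unshelve. all: by end_near. Qed.

Lemma sb_flat k : smooth_bounded (flat k).
Proof.
move=> m; elim: m k => [|m IH] k.
  by exists k`!%:R; split=> // x; exact: flat_bounded.
have [A HA] := IH k.+1; have [B HB] := IH k.+2.
exists (Num.max k`!%:R (`|- k%:R| * A + B)); split=> [x|].
  by rewrite le_max flat_bounded.
exists (fun x => - k%:R * flat k.+1 x + flat k.+2 x); split.
  by move=> x; exact: is_derive_flat.
apply: bC_le (bCD (bCZ (- k%:R) HA) HB); by rewrite le_max lexx orbT.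
Qed.

Definition step_den x := flat 0 x + flat 0 (1 - x).

(** One of [x] and [1 - x] is at least [1/2], and [flat 0] is at least [exp (- 2)] from there on. *)
Lemma step_den_ge x : expR (- 2) <= step_den x.
Proof.
have h y : 2^-1 <= y -> expR (- 2) <= flat 0 y.
  move=> hy; have y0 : 0 < y by rewrite (lt_le_trans _ hy).
  rewrite /flat y0 expr0 mul1r ler_expR lerN2 -[leRHS]invrK lef_pV2//;
    by rewrite posrE ?invr_gt0.
have [hx|hx] := leP 2^-1 x.
  by apply: le_trans (h _ hx) _; rewrite lerDl flat_ge0.
apply: le_trans (h (1 - x) _) _; last by rewrite lerDr flat_ge0.
by lra.
Qed.

Definition step x := flat 0 x / step_den x.

Lemma sb_step : smooth_bounded step.
Proof.
apply: sbM; first exact: sb_flat.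
apply: (sb_inv (expR_gt0 (- 2)) step_den_ge).
apply: sbD; first exact: sb_flat.
have -> : (fun x => flat 0 (1 - x)) = fun x => flat 0 (- 1 * x + 1).
  by apply/funext => x; congr flat; ring.
by apply: sb_affine; exact: sb_flat.
Qed.

Let den_gt0 x : 0 < step_den x.
Proof. by apply: lt_le_trans (step_den_ge x); rewrite expR_gt0. Qed.

Lemma step0 x : x <= 0 -> step x = 0.
Proof. by move=> x0; rewrite /step flat_le0// mul0r. Qed.

Lemma step1 x : 1 <= x -> step x = 1.
Proof.
move=> x1; rewrite /step -[X in X / _](addr0) -(@flat_le0 0 (1 - x)) ?divff//.
  by rewrite gt_eqF// den_gt0.
by rewrite subr_le0.
Qed.

Lemma step_ge0 x : 0 <= step x.
Proof. by rewrite divr_ge0 ?flat_ge0// ltW// den_gt0. Qed.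

Lemma step_le1 x : step x <= 1.
Proof. by rewrite ler_pdivrMr ?den_gt0// mul1r lerDl flat_ge0. Qed.

(** A step rising over [[a - d, a]] times a step falling over [[b, b + d]]. *)
Definition bump (a b d x : R) : R :=
  step (d^-1 * x + (1 - d^-1 * a)) * step (- d^-1 * x + (1 + d^-1 * b)).

Lemma sb_bump a b d : smooth_bounded (bump a b d).
Proof. by apply: sbM; apply: sb_affine; exact: sb_step. Qed.

Lemma bump_ge0 a b d x : 0 <= bump a b d x.
Proof. by rewrite mulr_ge0 ?step_ge0. Qed.

Lemma bump_le1 a b d x : bump a b d x <= 1.
Proof. by rewrite mulr_ile1 ?step_ge0 ?step_le1. Qed.

Lemma bump1 a b d x : 0 < d -> a <= x <= b -> bump a b d x = 1.
Proof.
move=> d0 /andP[ax xb]; have d1 : 0 <= d^-1 by rewrite invr_ge0 ltW.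
have h1 : 0 <= d^-1 * (x - a) by rewrite mulr_ge0// subr_ge0.
have h2 : 0 <= d^-1 * (b - x) by rewrite mulr_ge0// subr_ge0.
by rewrite /bump !step1 ?mulr1//; lra.
Qed.

Lemma bump0 a b d x : 0 < d -> (x <= a - d) || (b + d <= x) -> bump a b d x = 0.
Proof.
move=> d0 h; have d1 : 0 < d^-1 by rewrite invr_gt0.
have dd : d^-1 * d = 1 by rewrite mulVf// gt_eqF.
rewrite /bump; case/orP: h => h.
  have : 0 <= d^-1 * (a - d - x) by rewrite mulr_ge0 ?(ltW d1)// subr_ge0.
  by rewrite !mulrBr dd => h1; rewrite step0 ?mul0r//; lra.
have : 0 <= d^-1 * (x - (b + d)) by rewrite mulr_ge0 ?(ltW d1)// subr_ge0.
rewrite mulrBr mulrDr dd => h1.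
by rewrite [X in _ * X]step0 ?mulr0//; lra.
Qed.

End StepFunction.

(** * Smooth functions on column vectors *)

Section Smoothness.
Variables (R : realType) (n : nat).
Implicit Types (f g : 'cV[R]_n -> R[i]) (s t : seq 'I_n) (x : 'cV[R]_n).

Definition cdifferentiable f x :=
  differentiable (re_fun f) x /\ differentiable (im_fun f) x.

Lemma cdifferentiableD f g x : cdifferentiable f x -> cdifferentiable g x ->
  cdifferentiable (fun y => f y + g y) x.
Proof.
move=> [f1 f2] [g1 g2]; split.
  have -> : re_fun (fun y => f y + g y) = re_fun f + re_fun g.
    by apply/funext => y; rewrite fctE /re_fun raddfD.
  exact: differentiableD.
have -> : im_fun (fun y => f y + g y) = im_fun f + im_fun g.
  by apply/funext => y; rewrite fctE /im_fun raddfD.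
exact: differentiableD.
Qed.

Lemma pderivD i f g : (forall x, cdifferentiable f x) ->
  (forall x, cdifferentiable g x) ->
  pderiv i (fun y => f y + g y) = fun x => pderiv i f x + pderiv i g x.
Proof.
move=> df dg; apply/funext => x; rewrite /pderiv.
have -> : re_fun (fun y => f y + g y) = re_fun f + re_fun g.
  by apply/funext => y; rewrite fctE /re_fun raddfD.
have -> : im_fun (fun y => f y + g y) = im_fun f + im_fun g.
  by apply/funext => y; rewrite fctE /im_fun raddfD.
have [f1 f2] := df x; have [g1 g2] := dg x.
by rewrite !deriveD//; exact: diff_derivable.
Qed.

Let re_mul f g : re_fun (fun y => f y * g y) =
  re_fun f * re_fun g - im_fun f * im_fun g.
Proof.
apply/funext => y; rewrite !fctE /re_fun /im_fun.
by case: (f y) => a b; case: (g y).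
Qed.

Let im_mul f g : im_fun (fun y => f y * g y) =
  re_fun f * im_fun g + im_fun f * re_fun g.
Proof.
apply/funext => y; rewrite !fctE /re_fun /im_fun.
by case: (f y) => a b; case: (g y).
Qed.

Lemma cdifferentiableM f g x : cdifferentiable f x -> cdifferentiable g x ->
  cdifferentiable (fun y => f y * g y) x.
Proof.
move=> [f1 f2] [g1 g2]; rewrite /cdifferentiable re_mul im_mul; split.
  by apply: differentiableB; exact: differentiableM.
by apply: differentiableD; exact: differentiableM.
Qed.

Lemma pderivM i f g : (forall x, cdifferentiable f x) ->
  (forall x, cdifferentiable g x) ->
  pderiv i (fun y => f y * g y) =
  fun x => pderiv i f x * g x + f x * pderiv i g x.
Proof.
move=> df dg; apply/funext => x; rewrite /pderiv re_mul im_mul.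
have [f1 f2] := df x; have [g1 g2] := dg x.
have D (u : 'cV[R]_n -> R) (v : 'cV[R]_n) : differentiable u x -> derivable u x v.
  exact: diff_derivable.
have DM (u v : 'cV[R]_n -> R) w : differentiable u x -> differentiable v x ->
    derivable (u * v) x w by move=> du dv; apply: D; exact: differentiableM.
rewrite (deriveB (DM _ _ _ f1 g1) (DM _ _ _ f2 g2)).
rewrite (deriveD (DM _ _ _ f1 g2) (DM _ _ _ f2 g1)).
rewrite !deriveM; try exact: D.
move: ('D_ _ (re_fun f) x) ('D_ _ (im_fun f) x) => p q.
move: ('D_ _ (re_fun g) x) ('D_ _ (im_fun g) x) => u v.
rewrite /re_fun /im_fun; case: (f x) => a b; case: (g x) => c e /=.
clear; apply/eqP; rewrite eq_complex /= /GRing.scale /=.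
by apply/andP; split; apply/eqP; ring.
Qed.

(** Derivatives are peeled off on the inside here, which suits the Leibniz induction, whereas
    [pderivs] adds them on the outside; this is why words are split by [rcons]. *)
Fixpoint Csm (m : nat) f : Prop :=
  if m is m'.+1 then (forall x, cdifferentiable f x) /\
    forall i, Csm m' (pderiv i f) else True.

Lemma CsmS m f : Csm m.+1 f -> Csm m f.
Proof.
elim: m f => [//|m IH] f [df Hf]; split=> // i.
exact: IH (Hf i).
Qed.

Lemma pderivs_rcons s i f : pderivs (rcons s i) f = pderivs s (pderiv i f).
Proof. by rewrite /pderivs foldr_rcons. Qed.

Lemma CsmP m f : Csm m f <->
  forall s, (size s < m)%N -> forall x, cdifferentiable (pderivs s f) x.
Proof.
elim: m f => [|m IH] f; first by split.
split=> [[df Hf] s sm x|H].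
  case/lastP: s sm => [//|s i]; rewrite size_rcons pderivs_rcons ltnS => sm.
  by have /IH := Hf i; exact.
split=> [x|i]; first exact: (H [::]).
by apply/IH => s sm x; rewrite -pderivs_rcons; apply: H; rewrite size_rcons.
Qed.

Lemma CsmD m f g : Csm m f -> Csm m g -> Csm m (fun x => f x + g x).
Proof.
elim: m f g => [//|m IH] f g [df Hf] [dg Hg]; split=> [x|i].
  exact: cdifferentiableD.
by rewrite pderivD//; exact: IH (Hf i) (Hg i).
Qed.

Lemma CsmM m f g : Csm m f -> Csm m g -> Csm m (fun x => f x * g x).
Proof.
elim: m f g => [//|m IH] f g Hf Hg; case: (Hf) (Hg) => [df Hf'] [dg Hg'].
split=> [x|i]; first exact: cdifferentiableM.
rewrite pderivM//; apply: CsmD; first exact: IH (Hf' i) (CsmS Hg).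
exact: IH (CsmS Hf) (Hg' i).
Qed.

Lemma pderivsD m f g s : Csm m f -> Csm m g -> (size s <= m)%N ->
  pderivs s (fun x => f x + g x) = fun x => pderivs s f x + pderivs s g x.
Proof.
elim: m f g s => [|m IH] f g s.
  by case: s => [|i s] _ _ sm; last by rewrite ltn0 in sm.
case=> [df Hf] [dg Hg]; case/lastP: s => [//|s i].
rewrite size_rcons ltnS => sm; rewrite !pderivs_rcons pderivD//.
exact: IH (Hf i) (Hg i) sm.
Qed.

Lemma cabs_ge0 (z : R[i]) : 0 <= cabs z.
Proof. by case: z => a b; exact: sqrtr_ge0. Qed.

(** [F] and [B] bound derivatives at the single point [x], so they may carry the decay or growth of
    a weight at [x]. *)
Lemma pderivs_prod_le m f g x F B : Csm m f -> Csm m g ->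
  (forall t, (size t <= m)%N -> cabs (pderivs t f x) <= F) ->
  (forall t, (size t <= m)%N -> cabs (pderivs t g x) <= B) ->
  forall s, (size s <= m)%N ->
  cabs (pderivs s (fun y => f y * g y) x) <= 2 ^+ m * (F * B).
Proof.
elim: m f g => [|m IH] f g Hf Hg fF gB s sm.
  case: s sm => // _; rewrite /= ComplexField.Normc.normcM expr0 mul1r.
  by apply: ler_pM; rewrite ?cabs_ge0 ?(fF [::]) ?(gB [::]).
have FB0 : 0 <= F * B.
  by rewrite mulr_ge0// ?(le_trans _ (fF [::] isT)) ?(le_trans _ (gB [::] isT)) ?cabs_ge0.
case: (Hf) (Hg) => [df Hf'] [dg Hg'].
case/lastP: s sm => [_|s i].
  rewrite /= ComplexField.Normc.normcM.
  apply: le_trans (ler_pM _ _ (fF [::] isT) (gB [::] isT)) _; rewrite ?cabs_ge0//.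
  by rewrite ler_peMl// exprn_ege1// ler1n.
rewrite size_rcons ltnS => sm; rewrite pderivs_rcons pderivM//.
have C1 := CsmM (Hf' i) (CsmS Hg); have C2 := CsmM (CsmS Hf) (Hg' i).
rewrite (pderivsD C1 C2 sm) exprS -mulrA mulr_natl mulr2n.
apply: le_trans (le_normcD _ _) _; apply: lerD; apply: IH => //;
  try by [apply: Hf'|apply: Hg'|apply: CsmS].
- by move=> t tm; rewrite -pderivs_rcons fF// size_rcons.
- by move=> t tm; rewrite gB// leqW.
- by move=> t tm; rewrite fF// leqW.
- by move=> t tm; rewrite -pderivs_rcons gB// size_rcons.
Qed.

Definition coordf (j : 'I_n) (h : R -> R) : 'cV[R]_n -> R[i] :=
  fun x => (h (x j ord0))%:C.

Lemma cdifferentiable_coordf (j : 'I_n) (h h' : R -> R) x :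
  (forall y : R, is_derive y 1 h (h' y)) -> cdifferentiable (coordf j h) x.
Proof.
move=> dh; split; last by apply: (@differentiable_cst R _ _ (0 : R)).
apply: (@differentiable_comp _ _ _ _ (fun y : 'cV[R]_n => y j ord0) h).
  exact: differentiable_coord.
by apply/derivable1_diffP; have [] := dh (x j ord0).
Qed.

Lemma pderiv_coordf (i j : 'I_n) (h h' : R -> R) :
  (forall y : R, is_derive y 1 h (h' y)) ->
  pderiv i (coordf j h) = if i == j then coordf j h' else fun=> 0.
Proof.
move=> dh; apply/funext => x; rewrite /pderiv.
have -> : im_fun (coordf j h) = cst 0 by [].
rewrite derive_cst; have [->|ij] := eqVneq i j.
  congr (_ +i* _); have [_ <-] := dh (x j ord0); rewrite /derive.
  do 3 f_equal; apply/funext => k.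
  by rewrite /= /re_fun /coordf /= !mxE !eqxx.
apply/eqP; rewrite eq_complex /= eqxx andbT; apply/eqP.
rewrite -[RHS](@derive_cst R _ _ (0 : R) x (delta_mx i ord0)) /derive.
do 3 f_equal; apply/funext => k.
by rewrite /= /re_fun /coordf /= !mxE eq_sym (negbTE ij)/= mulr0 add0r !subrr.
Qed.

Lemma pderiv0 i : pderiv i (fun=> 0 : R[i]) = (fun=> 0) :> ('cV[R]_n -> R[i]).
Proof.
apply/funext => x; rewrite /pderiv.
have -> : re_fun (fun=> 0) = cst 0 :> ('cV[R]_n -> R) by [].
have -> : im_fun (fun=> 0) = cst 0 :> ('cV[R]_n -> R) by [].
by rewrite derive_cst.
Qed.

Lemma pderivs0 s : pderivs s (fun=> 0 : R[i]) = (fun=> 0) :> ('cV[R]_n -> R[i]).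
Proof. by elim: s => //= i s ->; exact: pderiv0. Qed.

Lemma Csm0 m : Csm m (fun=> 0 : R[i]).
Proof.
elim: m => // m IH; split=> [x|i]; last by rewrite pderiv0.
by split; exact: (@differentiable_cst R _ _ (0 : R)).
Qed.

Lemma cabs_real (r : R) : cabs r%:C = `|r|.
Proof. by rewrite /= expr0n /= addr0 sqrtr_sqr. Qed.

Lemma Csm_coordf m A j h : bC m A h -> Csm m (coordf j h).
Proof.
elim: m h => [//|m IH] h [_ [h' [dh bh]]]; split=> [x|i].
  exact: cdifferentiable_coordf dh.
rewrite (pderiv_coordf i j dh); case: ifP => _; last exact: Csm0.
exact: IH bh.
Qed.

Lemma pderivs_coordf_le m A j h x s : bC m A h -> (size s <= m)%N ->
  cabs (pderivs s (coordf j h) x) <= A.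
Proof.
elim: m h s => [|m IH] h s Hh.
  by case: s => // _; rewrite cabs_real; exact: bC_norm Hh.
case/lastP: s => [_|s i]; first by rewrite cabs_real; exact: bC_norm Hh.
case: (Hh) => _ [h' [dh bh]]; rewrite size_rcons ltnS pderivs_rcons => sm.
rewrite (pderiv_coordf i j dh); case: ifP => _; first exact: IH.
by rewrite pderivs0 ComplexField.Normc.normc0 (bC_ge0 Hh).
Qed.

End Smoothness.

(** * Seminorms, multipliers and truncations of Schwartz functions *)

Section MatrixNorm.
Variables (R : realType) (n : nat).

Lemma colv_norm_le (x : 'cV[R]_n) (B : R) : 0 <= B ->
  `|x| <= B <-> forall i, `|x i ord0| <= B.
Proof.
move=> B0; rewrite [`|x|]/Num.norm /= mx_normrE; split=> [/bigmax_leP[_ H] i|H].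
  exact: (H (i, ord0)).
by apply/bigmax_leP; split=> // -[i j] _ /=; rewrite ord1.
Qed.

Lemma coord_norm_le (x : 'cV[R]_n) i : `|x i ord0| <= `|x|.
Proof. by have [/(_ (lexx _))] := colv_norm_le x (normr_ge0 x). Qed.

End MatrixNorm.

(** * Pullback along coordinate projections *)

Section Reindexing.
Variables (R : realType) (p n : nat) (sigma : 'I_n -> 'I_p).
Hypothesis sigma_inj : injective sigma.
Local Notation pr := (fun z : 'cV[R]_p => rowsub sigma z).

Lemma rowsub_differentiable (z : 'cV[R]_p) : differentiable pr z.
Proof.
pose l : {linear 'cV[R]_p -> 'cV[R]_n} := mxsub sigma id.
have c : continuous l.
  move=> u A /nbhs_ballP[e /= e0 eA].
  apply/nbhs_ballP; exists e => //= v [_ uv]; apply: eA; split => // i j.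
  by apply: (le_lt_trans _ (uv (sigma i) j)); rewrite !mxE.
exact: (linear_differentiable z c).
Qed.

Definition pullback (f : 'cV[R]_n -> R[i]) : 'cV[R]_p -> R[i] :=
  fun z => f (rowsub sigma z).

Lemma cdifferentiable_pullback f z : cdifferentiable f (rowsub sigma z) ->
  cdifferentiable (pullback f) z.
Proof.
case=> f1 f2; split.
  exact: (differentiable_comp (rowsub_differentiable z) f1).
exact: (differentiable_comp (rowsub_differentiable z) f2).
Qed.

(** Only directions selected by [sigma] contribute; injectivity makes the selecting index unique. *)
Lemma pderiv_pullback i f :
  pderiv i (pullback f) =
  if [pick a | sigma a == i] is Some a then pullback (pderiv a f) else fun=> 0.
Proof.
case: pickP => [a /eqP <-|H]; apply/funext => z; rewrite /pderiv /pullback.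
  have E k : rowsub sigma (k *: delta_mx (sigma a) ord0 + z) =
      k *: delta_mx a ord0 + rowsub sigma z :> 'cV[R]_n.
    by apply/matrixP => b c; rewrite !mxE (inj_eq sigma_inj).
  congr (_ +i* _); rewrite /derive; do 3 f_equal; apply/funext => k;
    by rewrite /= /re_fun /im_fun E.
have E k : rowsub sigma (k *: delta_mx i ord0 + z) = rowsub sigma z :> 'cV[R]_n.
  by apply/matrixP => b c; rewrite !mxE H /= mulr0 add0r.
apply/eqP; rewrite eq_complex /= -(@derive_cst R _ _ (0 : R) z (delta_mx i ord0)).
by apply/andP; split; apply/eqP; rewrite /derive; do 3 f_equal; apply/funext => k;
  rewrite /= /re_fun /im_fun E !subrr.
Qed.

Lemma Csm_pullback m f : Csm m f -> Csm m (pullback f).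
Proof.
elim: m f => [//|m IH] f [df Hf]; split=> [x|i].
  exact: cdifferentiable_pullback.
rewrite pderiv_pullback; case: pickP => [a _|_]; last exact: Csm0.
exact: IH (Hf a).
Qed.

Lemma pderivs_pullback_le m f z F : 0 <= F ->
  (forall t, (size t <= m)%N -> cabs (pderivs t f (rowsub sigma z)) <= F) ->
  forall s, (size s <= m)%N -> cabs (pderivs s (pullback f) z) <= F.
Proof.
move=> F0; elim: m f => [|m IH] f fF s.
  by case: s => [|i s]; rewrite ?ltn0// => _; exact: (fF [::]).
case/lastP: s => [_|s i]; first exact: (fF [::]).
rewrite size_rcons ltnS pderivs_rcons pderiv_pullback => sm.
case: pickP => [a _|_]; last by rewrite pderivs0 ComplexField.Normc.normc0.
by apply: IH => // t tm; rewrite -pderivs_rcons fF// size_rcons.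
Qed.

End Reindexing.

Section Seminorms.
Variables (R : realType) (n : nat).
Implicit Types (f g : schwartz R n) (s t : seq 'I_n) (x : 'cV[R]_n).

(** There are finitely many words of length at most [m], so bounds depending on [s] can be made
    uniform; this makes the supremum defining [sn] finite. *)
Lemma uniform_bound (P : seq 'I_n -> R -> Prop) m :
  (forall s C C', C <= C' -> P s C -> P s C') ->
  (forall s, exists C, P s C) ->
  exists C, forall s, (size s <= m)%N -> P s C.
Proof.
elim: m P => [|m IH] P Pmono PC.
  have [C hC] := PC [::]; exists C => -[|i s]; first by [].
  by rewrite ltn0.
have /choice[c hc] : forall i : 'I_n, exists C,
    forall s, (size s <= m)%N -> P (i :: s) C.
  move=> i; apply: (IH (fun s => P (i :: s))) => [s C C'|s]; first exact: Pmono.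
  exact: PC.
have [C0 hC0] := PC [::].
exists (Num.max C0 (\big[Num.max/C0]_i c i)) => -[_|i s].
  by apply: Pmono hC0; rewrite le_max lexx.
rewrite ltnS => sm; apply: Pmono (hc i s sm).
by rewrite le_max le_bigmax orbT.
Qed.

Lemma schwartz_Csm f m : Csm m f.
Proof.
apply/CsmP => s _ x; have /asboolP/(_ s)[+ _] := schwartz_funP f; exact.
Qed.

Lemma schwartzI (f : 'cV[R]_n -> R[i]) : (forall m, Csm m f) ->
  (forall s k, exists C, forall x, (1 + `|x|) ^+ k * cabs (pderivs s f x) <= C) ->
  f \in @schwartz_pred R n.
Proof.
move=> Hf fC; apply/asboolP => s; split; last exact: fC.
by move=> x; have /CsmP := Hf (size s).+1; exact.
Qed.

Lemma schwartzP f g : (forall x, f x = g x) -> f = g.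
Proof. by move=> fg; apply: val_inj; apply/funext. Qed.

Lemma sn_ub k m f s x : (size s <= m)%N ->
  (1 + `|x|) ^+ k * cabs (pderivs s f x) <= sn k m f.
Proof.
move=> sm; apply: ub_le_sup; last by exists s, x.
have [C hC] : exists C, forall s, (size s <= m)%N -> forall x,
    (1 + `|x|) ^+ k * cabs (pderivs s f x) <= C.
  apply: uniform_bound => [t C C' CC' h y|t]; first exact: le_trans CC'.
  by have /asboolP/(_ t)[_] := schwartz_funP f; exact.
by exists C => _ [t [y [tm ->]]]; exact: hC.
Qed.

Lemma sn_lub k m f B :
  (forall s x, (size s <= m)%N ->
    (1 + `|x|) ^+ k * cabs (pderivs s f x) <= B) -> sn k m f <= B.
Proof.
move=> H; apply: ge_sup; first by eexists; exists [::], 0.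
by move=> _ [s [x [sm ->]]]; exact: H.
Qed.

Lemma weight_ge0 x k : 0 <= (1 + `|x|) ^+ k.
Proof. by rewrite exprn_ge0// addr_ge0. Qed.

Lemma sn_ge0 k m f : 0 <= sn k m f.
Proof.
apply: le_trans (sn_ub k f (s := [::]) 0 _) => //.
by rewrite mulr_ge0 ?weight_ge0 ?cabs_ge0.
Qed.

Lemma sn_mono k k' m m' f : (k <= k')%N -> (m <= m')%N -> sn k m f <= sn k' m' f.
Proof.
move=> kk mm; apply: sn_lub => s x sm.
apply: le_trans (sn_ub k' f x (leq_trans sm mm)).
by rewrite ler_wpM2r ?cabs_ge0// ler_weXn2l// lerDl.
Qed.

Lemma pderivs_le_sn k m f s x : (size s <= m)%N ->
  cabs (pderivs s f x) <= sn k m f / (1 + `|x|) ^+ k.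
Proof.
move=> sm; rewrite ler_pdivlMr ?exprn_gt0 ?ltr_pwDl// mulrC.
exact: sn_ub.
Qed.

(** The default [0] makes this a total operation; for [smooth_bounded] functions [h] it is the
    genuine product. *)
Definition multiplier (j : 'I_n) (h : R -> R) f : schwartz R n :=
  if pselect ((fun x => coordf j h x * f x) \in @schwartz_pred R n) is left H
  then Schwartz H else 0.

Lemma multiplier_schwartz j h f : smooth_bounded h ->
  (fun x => coordf j h x * f x) \in @schwartz_pred R n.
Proof.
move=> sh; apply: schwartzI => [m|s k].
  have [A hA] := sh m; apply: CsmM; first exact: Csm_coordf hA.
  exact: schwartz_Csm.
have [A hA] := sh (size s).
exists (2 ^+ size s * (A * sn k (size s) f)) => x.
rewrite mulrC -ler_pdivlMr ?exprn_gt0 ?ltr_pwDl// -!mulrA.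
apply: (@pderivs_prod_le _ _ (size s)) => //.
- exact: Csm_coordf hA.
- exact: schwartz_Csm.
- by move=> t; exact: pderivs_coordf_le.
- by move=> t; exact: pderivs_le_sn.
Qed.

Lemma multiplierE j h f x : smooth_bounded h ->
  multiplier j h f x = (h (x j ord0))%:C * f x.
Proof.
move=> sh; rewrite /multiplier; case: pselect => // H.
by case: H; exact: multiplier_schwartz.
Qed.

Lemma multiplier_fun j h f : smooth_bounded h ->
  schwartz_fun (multiplier j h f) = fun x => coordf j h x * f x.
Proof. by move=> sh; apply/funext => x; rewrite multiplierE. Qed.

Lemma sn_multiplier j h f k m A : smooth_bounded h -> bC m A h ->
  sn k m (multiplier j h f) <= 2 ^+ m * (A * sn k m f).
Proof.
move=> sh hA; apply: sn_lub => s x sm; rewrite multiplier_fun//.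
rewrite mulrC -ler_pdivlMr ?exprn_gt0 ?ltr_pwDl// -!mulrA.
apply: (@pderivs_prod_le _ _ m) => //.
- exact: Csm_coordf hA.
- exact: schwartz_Csm.
- by move=> t; exact: pderivs_coordf_le.
- by move=> t; exact: pderivs_le_sn.
Qed.

(** Equal to [1] for [|r y| <= 1] and to [0] for [|r y| >= 2], hence an approximation of [1] as [r]
    tends to [0]. *)
Definition cutoff (r y : R) : R := bump (-1) 1 1 (r * y + 0).

Lemma sb_cutoff r : smooth_bounded (cutoff r).
Proof. by apply: sb_affine; exact: sb_bump. Qed.

Lemma cutoff1 r y : `|r * y| <= 1 -> cutoff r y = 1.
Proof. by rewrite ler_norml => h; rewrite /cutoff addr0 bump1. Qed.

Lemma cutoff0 r y : 2 <= `|r * y| -> cutoff r y = 0.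
Proof.
rewrite ler_normr => h; rewrite /cutoff addr0 bump0//.
by case/orP: h => h; apply/orP; [right|left]; lra.
Qed.

Definition truncation (j : 'I_n) (r : R) f := multiplier j (cutoff r) f.

Lemma truncationE j r f x : truncation j r f x = (cutoff r (x j ord0))%:C * f x.
Proof. by rewrite multiplierE//; exact: sb_cutoff. Qed.

(* Every derivative of the cutoff gains a factor r; at order zero the factor r
   is gained at the expense of one power of the weight 1 + |x|. *)
Lemma sn_truncation j k m : exists A, forall r f, 0 < r <= 1 ->
  sn k m (f - truncation j r f) <= r * A * sn k.+1 m f.
Proof.
have sb : smooth_bounded (bump (-1) 1 1 : R -> R) by exact: sb_bump.
have [A0] := sb m.+1 => -[_ [b [db bA]]]; have A0_ge0 := bC_ge0 bA.
pose A := Num.max 1 A0.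
exists (2 ^+ m * A) => r f /andP[r0 r1].
pose h y : R := 1 - cutoff r y.
have shh : smooth_bounded h by apply: sbB; [exact: sb_cst|exact: sb_cutoff].
have -> : f - truncation j r f = multiplier j h f.
  apply: schwartzP => x; rewrite multiplierE// /h rmorphB mulrBl mul1r.
  by rewrite -truncationE.
have dh (y : R) : is_derive y 1 h (- (r * b (r * y + 0))).
  have := is_deriveB (is_derive_cst (1 : R) y 1) (is_derive_affine (db (r * y + 0))).
  by rewrite sub0r.
have bh : bC m (r * A0) (fun y => - (r * b (r * y + 0))).
  have rle : `|r| <= 1 by rewrite gtr0_norm.
  apply: bCN; have := bCZ r (bC_affine 0 (lexx 1) rle bA).
  by rewrite gtr0_norm// expr1n mulr1.
have coordb x t : (size t <= m)%N ->
    cabs (pderivs t (coordf j h) x) <= r * A * (1 + `|x|).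
  case/lastP: t => [_|t i].
    rewrite [pderivs _ _]/= cabs_real /h.
    have [h1|h1] := leP `|r * x j ord0| 1.
      rewrite cutoff1// subrr normr0 mulr_ge0 ?addr_ge0//.
      by rewrite mulr_ge0 ?(ltW r0)// le_max ler01.
    have c0 : 0 <= cutoff r (x j ord0) by exact: bump_ge0.
    have c1 : cutoff r (x j ord0) <= 1 by exact: bump_le1.
    (* Here [1 < |r x_j|], so the trivial bound [1] is at most [r (1 + |x|)]. *)
    rewrite ger0_norm ?subr_ge0//; apply: (@le_trans _ _ 1).
      by rewrite lerBlDr lerDl.
    apply: (le_trans (ltW h1)).
    rewrite normrM gtr0_norm// -mulrA ler_wpM2l ?(ltW r0)//.
    apply: (@le_trans _ _ (1 * (1 + `|x|))).
      by rewrite mul1r (le_trans (coord_norm_le x j))// lerDr.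
    by rewrite ler_wpM2r ?addr_ge0// le_max lexx.
  rewrite size_rcons pderivs_rcons (pderiv_coordf i j dh) => tm.
  case: ifP => _; last first.
    rewrite pderivs0 ComplexField.Normc.normc0 mulr_ge0 ?addr_ge0//.
    by rewrite mulr_ge0 ?(ltW r0)// le_max ler01.
  apply: le_trans (pderivs_coordf_le j x bh (ltnW tm)) _.
  rewrite -mulrA ler_wpM2l ?(ltW r0)//; apply: (@le_trans _ _ A).
    by rewrite le_max lexx orbT.
  by rewrite ler_peMr ?le_max ?ler01// lerDl.
apply: sn_lub => s x sm; rewrite multiplier_fun//.
rewrite mulrC -ler_pdivlMr ?exprn_gt0 ?ltr_pwDl//.
have [B hB] := shh m.
apply: le_trans (pderivs_prod_le (Csm_coordf j hB) (schwartz_Csm f m)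
  (coordb x) (fun t => pderivs_le_sn k.+1 f x (s := t)) sm) _.
have w0 : 0 < 1 + `|x| by rewrite ltr_pwDl.
have wk : (1 + `|x|) ^+ k != 0 by rewrite gt_eqF// exprn_gt0.
rewrite exprS le_eqVlt; apply/orP; left; apply/eqP; field.
by rewrite wk gt_eqF.
Qed.

End Seminorms.

(** * Tempered distributions and locality *)

Section Tempered.
Variables (R : realType) (n : nat).
Implicit Types (f g : schwartz R n) (u : schwartz R n -> R[i]).

Lemma scalar_add u f g : scalar u -> u (f + g) = u f + u g.
Proof. by move=> su; have := su 1 f g; rewrite scale1r mul1r. Qed.

Lemma scalar_sub u f g : scalar u -> u (f - g) = u f - u g.
Proof. by move=> su; rewrite addrC -scaleN1r su mulN1r addrC. Qed.

Lemma cabs_le0 (z : R[i]) : cabs z <= 0 -> z = 0.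
Proof.
move=> z0; apply: ComplexField.Normc.eq0_normc; apply/eqP.
by rewrite eq_le z0 cabs_ge0.
Qed.

Lemma small_eq0 (z : R[i]) (B : R) :
  (forall r, 0 < r <= 1 -> cabs z <= r * B) -> z = 0.
Proof.
move=> H; apply: cabs_le0; apply/ler_addgt0Pr => e e0; rewrite add0r.
pose r := Num.min 1 (e / (1 + `|B|)).
have B1 : 0 < 1 + `|B| by rewrite ltr_pwDl.
have r0 : 0 < r by rewrite lt_min ltr01 divr_gt0.
have r1 : r <= 1 by rewrite ge_min lexx.
apply: le_trans (H r _) _; first by rewrite r0 r1.
apply: (@le_trans _ _ (r * (1 + `|B|))).
  by rewrite ler_wpM2l ?(ltW r0)// (le_trans (ler_norm B))// lerDr.
by rewrite -ler_pdivlMr// ge_min lexx orbT.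
Qed.

(** In the seminorm that controls [u], the truncations approach [f] at rate [r], with a constant
    depending on [f]. *)
Lemma tempered_truncation u j f : tempered u ->
  (forall r, 0 < r <= 1 -> u (truncation j r f) = 0) -> u f = 0.
Proof.
move=> [su [k [m [C uC]]]] H; have [A hA] := @sn_truncation R n j k m.
apply: (@small_eq0 _ (`|C| * (A * sn k.+1 m f))) => r r01.
have -> : u f = u (f - truncation j r f) by rewrite scalar_sub// H// subr0.
apply: le_trans (uC _) _.
apply: (@le_trans _ _ (`|C| * sn k m (f - truncation j r f))).
  by rewrite ler_wpM2r ?sn_ge0// ler_norm.
by rewrite mulrCA ler_wpM2l// mulrA hA.
Qed.

End Tempered.

Section Compactness.
Variables (R : realType) (n : nat).

Lemma closed_coord_le (i : 'I_n) (a : R) : closed [set x : 'cV[R]_n | x i ord0 <= a].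
Proof.
apply: (@preimage_closed _ _ (fun x : 'cV[R]_n => x i ord0) [set t | t <= a]).
  by move=> x _; exact: coord_continuous.
exact: closed_le.
Qed.

Lemma closed_coord_ge (i : 'I_n) (a : R) : closed [set x : 'cV[R]_n | a <= x i ord0].
Proof.
apply: (@preimage_closed _ _ (fun x : 'cV[R]_n => x i ord0) [set t | a <= t]).
  by move=> x _; exact: coord_continuous.
exact: closed_ge.
Qed.

Lemma compact_box (B : R) : compact [set x : 'cV[R]_n | forall i, `|x i ord0| <= B].
Proof.
pose I : set R := `[- B, B]%classic.
have cI : compact I by exact: segment_compact.
have c : continuous (trmx : 'rV[R]_n -> 'cV[R]_n).
  move=> u A /nbhs_ballP[e /= e0 eA].
  apply/nbhs_ballP; exists e => //= v [_ uv]; apply: eA; split => // i j.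
  by apply: (le_lt_trans _ (uv j i)); rewrite !mxE.
have := @continuous_compact _ _ (trmx : 'rV[R]_n -> 'cV[R]_n) _
  (continuous_subspaceT c) (@rV_compact R n (fun=> I) (fun=> cI)).
congr compact; apply/seteqP; split => [x [v /= vI <-] i|x /= xB].
  by have := vI i; rewrite mxE /I /= in_itv /= ler_norml.
exists (x^T); last by rewrite trmxK.
by move=> i; rewrite mxE /I /= in_itv /= -ler_norml.
Qed.

End Compactness.

(** * Tensor products of Schwartz functions *)

Section Tensor.
Variables (R : realType) (N : nat).
Implicit Types (f phi psi : schwartz R N).

Definition tensor_fun psi phi : 'cV[R]_(N + N) -> R[i] := fun z =>
  pullback (lshift N) psi z * pullback (@rshift N N) phi z.

Lemma tensor_schwartz psi phi : tensor_fun psi phi \in @schwartz_pred R (N + N).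
Proof.
have li := @lshift_inj N N; have ri := @rshift_inj N N.
apply: schwartzI => [m|s k].
  by apply: CsmM; apply: Csm_pullback => //; exact: schwartz_Csm.
set m := size s; exists (2 ^+ m * (sn k m psi * sn k m phi)) => z.
pose x := rowsub (lshift N) z; pose y := rowsub (@rshift N N) z.
have wx : 0 < (1 + `|x|) ^+ k by rewrite exprn_gt0// ltr_pwDl.
have wy : 0 < (1 + `|y|) ^+ k by rewrite exprn_gt0// ltr_pwDl.
(* For the maximum norm [1 + |z| <= (1 + |x|) (1 + |y|)], so the decay of the two factors pays for
   the weight in [z]. *)
have wz : (1 + `|z|) ^+ k <= (1 + `|x|) ^+ k * (1 + `|y|) ^+ k.
  rewrite -exprMn; have h : `|z| <= (1 + `|x|) * (1 + `|y|) - 1.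
    have h0 : 0 <= `|x| * `|y| by rewrite mulr_ge0.
    have x0 := normr_ge0 x; have y0 := normr_ge0 y.
    apply/colv_norm_le => [|i]; first by nra.
    case: (split_ordP i) => a ->.
      have := coord_norm_le x a; rewrite mxE; nra.
    have := coord_norm_le y a; rewrite mxE; nra.
  rewrite lerXn2r ?nnegrE ?mulr_ge0 ?addr_ge0//; lra.
have pl : forall t, (size t <= m)%N ->
    cabs (pderivs t (pullback (lshift N) psi) z) <= sn k m psi / (1 + `|x|) ^+ k.
  apply: (pderivs_pullback_le li); first by rewrite divr_ge0 ?sn_ge0 ?ltW.
  by move=> t; exact: pderivs_le_sn.
have pr : forall t, (size t <= m)%N ->
    cabs (pderivs t (pullback (@rshift N N) phi) z) <= sn k m phi / (1 + `|y|) ^+ k.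
  apply: (pderivs_pullback_le ri); first by rewrite divr_ge0 ?sn_ge0 ?ltW.
  by move=> t; exact: pderivs_le_sn.
have Cl := Csm_pullback li (schwartz_Csm psi m).
have Cr := Csm_pullback ri (schwartz_Csm phi m).
have := pderivs_prod_le Cl Cr pl pr (leqnn m).
rewrite -/(tensor_fun psi phi) => h.
apply: (le_trans (ler_wpM2r (cabs_ge0 _) wz)).
apply: (le_trans (ler_wpM2l (mulr_ge0 (ltW wx) (ltW wy)) h)).
rewrite le_eqVlt; apply/orP; left; apply/eqP; field.
by rewrite !gt_eqF.
Qed.

Definition tensor psi phi : schwartz R (N + N) := Schwartz (tensor_schwartz psi phi).

Lemma tensorE psi phi x x' : tensor psi phi (col_mx x x') = psi x * phi x'.
Proof.
rewrite /= /tensor_fun /pullback.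
have -> : rowsub (lshift N) (col_mx x x') = x.
  by apply/matrixP => i j; rewrite mxE col_mxEu.
have -> // : rowsub (@rshift N N) (col_mx x x') = x'.
by apply/matrixP => i j; rewrite mxE col_mxEd.
Qed.

End Tensor.

(** * Vanishing of a local form on separated supports *)

Section Locality.
Variables (R : realType) (N : nat) (D : schwartz R N -> schwartz R N -> R[i]).
Hypothesis D_tempered_l : forall phi, tempered (D^~ phi).
Hypothesis D_tempered_r : forall f, tempered (D f).
Hypothesis D_differential : differential_operator D.
Implicit Types (f phi : schwartz R N) (i j : 'I_N) (a b B : R) (x : 'cV[R]_N).

(** The kernel is evaluated at [phi] tensor [f], whose support lies where the [i]-th coordinate is
    at least [b] in the first factor and at most [a] in the second; this misses the diagonal. The
    bound [B] provides the compactness required by [supported_in]. *)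
Lemma local_box f phi i a b B : a < b ->
  (forall x, a < x i ord0 -> f x = 0) -> (forall x, x i ord0 < b -> phi x = 0) ->
  (forall x j, B < `|x j ord0| -> f x = 0 /\ phi x = 0) -> D f phi = 0.
Proof.
move=> ab fa pb fB; have [K [_ Kt Ks]] := D_differential.
rewrite -(Kt f phi (tensor phi f)); last by move=> x x'; exact: tensorE.
pose E : set 'cV[R]_(N + N) := [set z | forall k, `|z k ord0| <= B] `&`
  ([set z | b <= z (lshift N i) ord0] `&` [set z | z (@rshift N N i) ord0 <= a]).
have cbox := @compact_box R (N + N) B.
have cE : closed E.
  apply: closedI; first by apply: compact_closed => //; exact: norm_hausdorff.
  by apply: closedI; [exact: closed_coord_ge|exact: closed_coord_le].
have sE : schwartz_supp (tensor phi f) `<=` E.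
  rewrite /schwartz_supp (closure_id E).1//; apply: closure_subset => z /=.
  rewrite /tensor_fun /pullback mulf_eq0 negb_or => /andP[p0 f0].
  split=> [k|].
    rewrite leNgt; apply/negP => hk; case: (split_ordP k) hk => c -> hk.
      have [] := fB (rowsub (lshift N) z) c; first by rewrite mxE.
      by move=> _ h; rewrite h eqxx in p0.
    have [] := fB (rowsub (@rshift N N) z) c; first by rewrite mxE.
    by move=> h _; rewrite h eqxx in f0.
  split => /=.
    rewrite leNgt; apply/negP => h; move/eqP: p0; apply; apply: pb.
    by rewrite mxE.
  rewrite leNgt; apply/negP => h; move/eqP: f0; apply; apply: fa.
  by rewrite mxE.
apply: Ks.
  apply: (subclosed_compact _ cbox); first exact: closed_closure.
  by move=> z /sE[].
rewrite -subset0 => z [/sE[_ [/= h1 h2]] [x _ xz]].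
move: h1 h2; rewrite -xz col_mxEu col_mxEd => h1 h2.
by have := lt_le_trans ab h1; rewrite ltNge h2.
Qed.

Lemma local_halfspace f phi i a b : a < b ->
  (forall x, a < x i ord0 -> f x = 0) -> (forall x, x i ord0 < b -> phi x = 0) ->
  D f phi = 0.
Proof.
move=> ab fa pb.
(* The list [s] holds the coordinates in which no bound on the supports is known; truncating [f] and
   [phi] removes them one at a time. *)
suff : forall (s : seq 'I_N) B f phi,
   (forall x, a < x i ord0 -> f x = 0) -> (forall x, x i ord0 < b -> phi x = 0) ->
   (forall x j, j \notin s -> B < `|x j ord0| -> f x = 0 /\ phi x = 0) ->
   D f phi = 0.
  move=> /(_ (enum 'I_N) 0); apply=> // x j; by rewrite mem_enum.
elim=> [|j s IH] B {}f {}phi {}fa {}pb fB.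
  by apply: (local_box ab fa pb) => x j; exact: fB.
apply: (tempered_truncation (D_tempered_l phi) (j := j)) => r /andP[r0 r1].
apply: (tempered_truncation (D_tempered_r _) (j := j)) => r' /andP[r'0 r'1].
apply: (IH (Num.max B (Num.max (2 / r) (2 / r')))).
- by move=> x h; rewrite truncationE fa// mulr0.
- by move=> x h; rewrite truncationE pb// mulr0.
move=> x k ks; rewrite !gt_max !ltr_pdivrMr// => /andP[hB /andP[h h']].
rewrite !truncationE; have [kj|kj] := eqVneq k j.
  subst k; rewrite !cutoff0 ?mul0r//.
    by rewrite normrM (gtr0_norm r'0) mulrC ltW.
  by rewrite normrM (gtr0_norm r0) mulrC ltW.
have [|-> ->] := fB x k _ hB; first by rewrite inE negb_or kj.
by rewrite !mulr0.
Qed.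

End Locality.

(** * Modulations and reflections *)

Section LinearMaps.
Variables (K : pzRingType) (V W : lmodType K) (U : V -> W).
Hypothesis U_linear : linear U.

Lemma linear_at0 : U 0 = 0.
Proof. by have := U_linear (-1) 0 0; rewrite scaler0 addr0 scaleN1r addNr. Qed.

Lemma linear_add u v : U (u + v) = U u + U v.
Proof. by have := U_linear 1 u v; rewrite !scale1r. Qed.

Lemma linear_scale a u : U (a *: u) = a *: U u.
Proof. by have := U_linear a u 0; rewrite !addr0 linear_at0 addr0. Qed.

Lemma linear_sub u v : U (u - v) = U u - U v.
Proof. by rewrite addrC -scaleN1r U_linear scaleN1r addrC. Qed.

End LinearMaps.

Section Characters.
Variable R : realType.

Lemma chiD (a b : R) : chi (a + b) = chi a * chi b.
Proof.
rewrite /chi !mulrDr sinD cosD; apply/eqP; rewrite eq_complex /=.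
by apply/andP; split; apply/eqP; ring.
Qed.

Lemma chi0 : chi (0 : R) = 1.
Proof. by rewrite /chi mulr0 cos0 sin0. Qed.

Lemma chi_mulN (a : R) : chi (- a) * chi a = 1.
Proof. by rewrite -chiD addNr chi0. Qed.

Lemma chi_conj (a : R) : (chi a)^* = chi (- a).
Proof. by rewrite /chi mulrN sinN cosN. Qed.

Lemma chi_cos (a : R) : chi a + chi (- a) = 2 * (cos (2 * pi * a))%:C.
Proof.
rewrite /chi mulrN sinN cosN; apply/eqP; rewrite eq_complex /=.
by apply/andP; split; apply/eqP; ring.
Qed.

End Characters.

Section Modulation.
Variables (R : realType) (N : nat).
Local Notation SX := (schwartz R N).
Implicit Types (f g : SX) (x y : 'cV[R]_N) (i : 'I_N) (t : R).

(** Multiplication by [chi (t x_i)], the action of an element of [Y], assembled from the real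
    multipliers cosine and sine. *)
Definition modulation i t f : SX :=
  multiplier i (fun r => cos (2 * pi * t * r + 0)) f +
  'i *: multiplier i (fun r => sin (2 * pi * t * r + 0)) f.

Lemma modulationE i t f x : modulation i t f x = chi (t * x i ord0) * f x.
Proof.
have sc : smooth_bounded (fun r : R => cos (2 * pi * t * r + 0)).
  by apply: sb_affine; exact: sb_cos.
have ss : smooth_bounded (fun r : R => sin (2 * pi * t * r + 0)).
  by apply: sb_affine; exact: sb_sin.
rewrite /modulation; transitivity
  (multiplier i (fun r => cos (2 * pi * t * r + 0)) f x +
  'i * multiplier i (fun r => sin (2 * pi * t * r + 0)) f x) => //.
rewrite !multiplierE// mulrA -mulrDl; congr (_ * _).
rewrite !addr0 /chi mulrA; apply/eqP; rewrite eq_complex /=.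
by apply/andP; split; apply/eqP; ring.
Qed.

Lemma schwartzDE f g x : (f + g) x = f x + g x. Proof. by []. Qed.
Lemma schwartzBE f g x : (f - g) x = f x - g x. Proof. by []. Qed.
Lemma schwartzZE a f x : (a *: f) x = a * f x. Proof. by []. Qed.

Lemma sform_inY_inX (y x : 'cV[R]_N) : sform (inY y) (inX x) = - (y^T *m x) ord0 ord0.
Proof.
rewrite /sform /inY /inX tr_col_mx mul_row_block mul_row_col.
by rewrite trmx0 !mulmx0 ?mul0mx !add0r !addr0 mulmxN mulmx1 mulNmx mxE.
Qed.

Lemma sform_inX_inY (x y : 'cV[R]_N) : sform (inX x) (inY y) = (x^T *m y) ord0 ord0.
Proof.
rewrite /sform /inY /inX tr_col_mx mul_row_block mul_row_col.
by rewrite trmx0 ?mul0mx !mulmx0 ?addr0 ?add0r mulmx1.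
Qed.

Lemma dot_delta (x : 'cV[R]_N) i :
  (x^T *m (delta_mx i ord0 : 'cV[R]_N)) ord0 ord0 = x i ord0.
Proof.
rewrite mxE (bigD1 i)//= !mxE !eqxx mulr1 big1 ?addr0// => j ji.
by rewrite !mxE (negbTE ji) mulr0.
Qed.

Lemma heis_inY i t f x :
  heis (inY ((- t) *: delta_mx i ord0)) f x = chi (t * x i ord0) * f x.
Proof.
rewrite /heis /inY col_mxKu col_mxKd subr0.
have -> : @inX R N 0 = 0 by rewrite /inX col_mx0.
have -> w : sform w (0 : 'cV[R]_(N + N)) = 0 by rewrite /sform mulmx0 mxE.
rewrite mulr0 subr0 sform_inY_inX linearZ /= -scalemxAl mxE mulNr opprK.
by rewrite -[in (_ *m _)](trmxK x) -trmx_mul mxE dot_delta.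
Qed.

Lemma heis_inX u f x : heis (inX u) f x = f (x - u).
Proof.
rewrite /heis /inX col_mxKu col_mxKd.
have -> : @inY R N 0 = 0 by rewrite /inY col_mx0.
have s0 w : sform (0 : 'cV[R]_(N + N)) w = 0.
  by rewrite /sform trmx0 !mul0mx mxE.
by rewrite !s0 mulr0 subr0 chi0 mul1r.
Qed.

Lemma implements_modulation (p : mpelt R N) i t f x : implements p ->
  p.2 (modulation i t f) x =
  heis (p.1 *m inY ((- t) *: delta_mx i ord0)) (p.2 f) x.
Proof.
case=> _ _ _ _ /(_ (inY ((- t) *: delta_mx i ord0)) f (modulation i t f)) -> //.
by apply/funext => y; rewrite modulationE heis_inY.
Qed.

End Modulation.

Lemma slab_dist (R : realType) (L a y d r : R) : 0 < d ->
  L - d / 2 < r -> r < a + d / 2 -> `|r - y| <= `|L| + `|a| + `|y| + d + 1.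
Proof.
move=> d0 h1 h2.
have := ler_norm L; have := ler_norm (- L); have := ler_norm a.
have := ler_norm (- a); have := ler_norm y; have := ler_norm (- y).
by rewrite !normrN ler_norml => *; apply/andP; split; lra.
Qed.

(** * Operators inverting the modulations reflect supports *)

Section Reflection.
Variables (R : realType) (N : nat) (i : 'I_N) (U : schwartz R N -> schwartz R N).
Implicit Types (f g : schwartz R N) (x y : 'cV[R]_N).
Hypothesis U_linear : linear U.
Hypothesis U_modulation : forall t f x,
  U (modulation i t f) x = chi (- (t * x i ord0)) * U f x.

(* A function f supported in the slab is divisible by the function
   1 - cos (w (x - y0)), which the operator turns into a multiplication by a
   function vanishing at y. *)
Lemma reflection_slab f (L a : R) y :
  (forall x, (x i ord0 < L) || (a < x i ord0) -> f x = 0) ->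
  (- y i ord0 < L) || (a < - y i ord0) -> U f y = 0.
Proof.
set y0 := - y i ord0 => fs hy.
(* [d] is the distance from the reflected coordinate [y0] to the slab; the bump below extends the
   slab by [d / 2] only. *)
have [d [d0 dL]] : exists d : R, 0 < d /\ (y0 + d <= L \/ a + d <= y0).
  case/orP: hy => h; [exists (L - y0)|exists (y0 - a)];
    rewrite subr_gt0; split=> //;
    [left|right]; lra.
pose b := bump L a (d / 2).
(* [M] bounds [|r - y0|] on the enlarged slab; with [w = pi / M] the phase [w (r - y0)] stays within
   [[- pi, pi]], where the cosine decreases in the absolute value. *)
pose M : R := `|L| + `|a| + `|y0| + d + 1.
have M0 : 0 < M by rewrite ltr_wpDl// !addr_ge0// ltW.
pose t := (2 * M)^-1; pose w : R := pi / M.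
have wE : 2 * pi * t = w by rewrite /t /w; field; rewrite gt_eqF.
have w0 : 0 < w by rewrite divr_gt0// pi_gt0.
have wM : w * M = pi by rewrite /w divfK// gt_eqF.
have dM : d / 2 <= M.
  rewrite /M; have := normr_ge0 L; have := normr_ge0 a; have := normr_ge0 y0.
  by lra.
pose k := cos (w * (d / 2)).
have w2 : 0 < w * (d / 2) by rewrite mulr_gt0// divr_gt0.
have w2p : w * (d / 2) <= pi by rewrite -wM ler_wpM2l// ltW.
have k1 : k < 1.
  by rewrite /k -[X in _ < X]cos0 ltr_cos ?in_itv //= ?lexx ?pi_ge0 ?(ltW w2).
(* On the slab [q] is [1 - cos (w (r - y0))], and off its enlargement it is [1]; the bump keeps it
   above [c], so that [1 / q] is a multiplier. *)
pose q r := 1 - b r * cos (w * r + - (w * y0)).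
pose c := 1 - Num.max 0 k.
have c0 : 0 < c by rewrite subr_gt0 gt_max ltr01.
have qc r : c <= q r.
  rewrite /c /q lerD2l lerN2.
  have b0 : 0 <= b r by exact: bump_ge0.
  have b1 : b r <= 1 by exact: bump_le1.
  have d20 : 0 < d / 2 by rewrite divr_gt0.
  have [/orP h|/norP[]] := boolP ((r <= L - d / 2) || (a + d / 2 <= r)).
    by rewrite /b bump0 ?mul0r ?le_max ?lexx//; apply/orP.
  rewrite -!ltNge => h1 h2.
  have cosk : cos (w * r + - (w * y0)) <= k.
    rewrite -mulrBr /k.
    have rM : `|r - y0| <= M by exact: slab_dist.
    have dr : d / 2 <= `|r - y0|.
      by rewrite ler_normr; case: dL => ?; apply/orP; [left|right]; lra.
    have -> : cos (w * (r - y0)) = cos (w * `|r - y0|).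
      have [h|h] := leP 0 (r - y0); first by rewrite ger0_norm.
      by rewrite ltr0_norm// mulrN cosN.
    rewrite leNgt ltr_cos ?in_itv /= -?leNgt.
    - by rewrite ler_wpM2l// ltW.
    - by rewrite mulr_ge0 ?(ltW w0)//= -wM ler_wpM2l// ltW.
    - by rewrite (ltW w2).
  have [h|h] := leP 0 (cos (w * r + - (w * y0))).
    by rewrite le_max; apply/orP; right; apply: le_trans cosk; rewrite ler_piMl.
  by rewrite le_max; apply/orP; left; rewrite mulr_ge0_le0// ltW.
have sq : smooth_bounded q.
  apply: sbB; first exact: sb_cst.
  by apply: sbM; [exact: sb_bump|apply: sb_affine; exact: sb_cos].
have sqV := sb_inv c0 qc sq.
pose g := multiplier i (fun r => (q r)^-1) f.
(* This writes [f] as [(1 - cos (w (x_i - y0))) g], the cosine being half a sum of two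
   characters. *)
have fE : f = g - 2^-1 *: (chi (- (t * y0)) *: modulation i t g +
                           chi (t * y0) *: modulation i (- t) g).
  apply: schwartzP => x; rewrite schwartzBE schwartzZE schwartzDE !schwartzZE.
  rewrite !modulationE !mulrA -!chiD -mulrDl.
  have -> : - (t * y0) + t * x i ord0 = t * (x i ord0 - y0) by ring.
  have -> : t * y0 + - t * x i ord0 = - (t * (x i ord0 - y0)) by ring.
  have -> : chi (t * (x i ord0 - y0)) + chi (- (t * (x i ord0 - y0))) =
      2 * (cos (w * x i ord0 - w * y0))%:C.
    by rewrite chi_cos -wE; congr (2 * (cos _)%:C); ring.
  have half (C G : R[i]) : G - 2^-1 * (2 * C * G) = (1 - C) * G.
    by rewrite !mulrA mulVf ?pnatr_eq0// mul1r mulrBl mul1r.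
  rewrite half /g multiplierE// mulrA.
  have [h|] := boolP ((x i ord0 < L) || (a < x i ord0)).
    by rewrite fs// !mulr0.
  rewrite negb_or -!leNgt => /andP[h1 h2].
  rewrite -[LHS]mul1r; congr (_ * _).
  have -> : q (x i ord0) = 1 - cos (w * x i ord0 - w * y0).
    by rewrite /q /b bump1 ?mul1r ?h1// divr_gt0.
  rewrite -(rmorph1 (real_complex R)) -rmorphB -rmorphM divff//.
  rewrite gt_eqF//; apply: (lt_le_trans c0); have := qc (x i ord0).
  by rewrite /q /b bump1 ?mul1r ?h1// divr_gt0.
(* As [y_i = - y0], each of the two modulated terms contributes exactly [U g y], and half their sum
   cancels the first term. *)
rewrite [in LHS]fE; move: g {fE} => g.
rewrite (linear_sub U_linear) (linear_scale U_linear) (linear_add U_linear).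
rewrite !(linear_scale U_linear).
rewrite schwartzBE schwartzZE schwartzDE !schwartzZE !U_modulation !mulrA -!chiD.
rewrite /y0 mulrN mulNr !opprK subrr addNr chi0 mul1r.
have -> : U g y + U g y = 2 * U g y by ring.
by rewrite mulrA mulVf ?pnatr_eq0// mul1r subrr.
Qed.

End Reflection.

(** * Distributions supported on a hyperplane *)

Section Oscillation.
Variable R : realType.
Implicit Types (h b : R -> R).

(** The witnesses in [bC] may depend on [m], but derivatives are unique, so a single [h'] serves
    every order. *)
Lemma sb_derivative h : smooth_bounded h ->
  exists2 h' : R -> R, forall x : R, is_derive x 1 h (h' x) & smooth_bounded h'.
Proof.
move=> sh; have [A0 [_ [h' [dh _]]]] := sh 1%N; exists h' => // m.
have [A [_ [k [dk kA]]]] := sh m.+1; exists A.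
suff -> : h' = k by [].
apply/funext => x; have [_ <-] := dh x; by have [_ <-] := dk x.
Qed.

Lemma bC_exp m A n h : bC m A h ->
  bC m ((2 ^+ m * A) ^+ n) (fun x => h x ^+ n).
Proof.
move=> hA; elim: n => [|n IH].
  rewrite expr0; have := bC_cst m (1 : R); rewrite normr1.
  by apply: bC_ext => x; rewrite expr0.
have := bCM hA IH; rewrite exprS !mulrA.
by apply: bC_ext => x; rewrite exprS.
Qed.

Lemma one_minus_cos_le (x : R) : `|1 - cos x| <= `|x|.
Proof.
have pos (y : R) : 0 <= y -> `|1 - cos y| <= y.
  rewrite le_eqVlt => /predU1P[<-|y0]; first by rewrite cos0 subrr normr0.
  have c : {within `[0, y], continuous (@cos R)}.
    by apply: continuous_subspaceT => z; exact: continuous_cos.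
  have [z _] := MVT y0 (fun z _ => is_derive_cos z) c.
  rewrite cos0 subr0 distrC => ->; rewrite normrM normrN (gtr0_norm y0).
  by rewrite ler_piMl ?sin_max// ltW.
have [x0|x0] := leP 0 x; first by rewrite (ger0_norm x0) pos.
by rewrite (ltr0_norm x0) -cosN pos// oppr_ge0 ltW.
Qed.

(** Where [|y| <= 2], [1 - cos (w r y)] is [O(r)]; a derivative either falls on [b], which keeps the
    support, or brings out a factor [r]. The constant [A] is uniform in [r]. *)
Lemma bC_one_minus_cos b (w : R) m : smooth_bounded b ->
  (forall y, 2 < `|y| -> b y = 0) ->
  exists A : R, forall r : R, 0 < r <= 1 ->
    bC m (A * r) (fun y => b y * (1 - cos (w * r * y + 0))).
Proof.
have pt (c : R -> R) (B r y : R) : 0 < r <= 1 -> (forall y, 2 < `|y| -> c y = 0) ->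
    (forall y, `|c y| <= B) -> `|c y * (1 - cos (w * r * y + 0))| <= B * `|w| * 2 * r.
  move=> /andP[r0 r1] c0 cB; have B0 := le_trans (normr_ge0 _) (cB 0).
  have [y2|y2] := ltP 2 `|y|.
    by rewrite c0// mul0r normr0 !mulr_ge0// ltW.
  rewrite normrM addr0 -!mulrA ler_pM//.
  apply: le_trans (one_minus_cos_le _) _; rewrite !normrM (gtr0_norm r0).
  by rewrite ler_wpM2l// mulrC ler_wpM2r// ltW.
elim: m b => [|m IH] b sb b0.
  have [B [bB _]] := sb 0%N; exists (B * `|w| * 2) => r r01.
  by split=> // y; exact: pt.
have [b' db sb'] := sb_derivative sb.
have b'0 y : 2 < `|y| -> b' y = 0.
  move=> y2; have [_ <-] := db y.
  have [_ <-] : is_derive y 1 b (0 : R); last by [].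
  apply: (near_eq_is_derive _ (is_derive_cst 0 y 1)).
  have : \forall z \near y, 2 < `|z|.
    have : `|z| @[z --> y] --> `|y| by apply: cvg_norm.
    by move/cvgr_gt; apply.
  by apply: filterS => z z2; rewrite b0.
have [A1 H1] := IH _ sb' b'0.
have [B bB] := sb m; have [B1 bB1] := sb m.+1.
pose K := Num.max 1 `|w|.
pose S := 2 ^+ m * (B * (1 * K ^+ m)) * `|w|.
exists (Num.max (B1 * `|w| * 2) (A1 + S)) => r /[dup] r01 /andP[r0 r1].
split=> [y|].
  apply: le_trans (@pt b B1 r y r01 b0 _) _; first by move=> z; exact: bC_norm bB1.
  by rewrite ler_wpM2r ?(ltW r0)// le_max lexx.
exists (fun y => b' y * (1 - cos (w * r * y + 0)) +
   w * r * (b y * sin (w * r * y + 0))); split.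
  move=> y; have dc := is_derive_affine (is_derive_cos (w * r * y + 0)).
  have d1 : is_derive y 1 (fun y => 1 - cos (w * r * y + 0))
      (0 - w * r * - sin (w * r * y + 0)).
    exact: is_deriveB (is_derive_cst (1 : R) y 1) dc.
  have := is_derive_mul (db y) d1 => /is_derive_eq; apply; ring.
have K1 : 1 <= K by rewrite le_max lexx.
have wK : `|w * r| <= K.
  by rewrite /K le_max normrM (gtr0_norm r0) ler_piMr ?orbT.
have hs : bC m 1 (@sin R).
  by have [+ _] := bC_sin_cos m (0 : R); apply: bC_ext => x; rewrite addr0.
apply: bC_le (bCD (H1 r r01) (bCZ (w * r) (bCM bB (bC_affine 0 K1 wK hs)))).
rewrite normrM (gtr0_norm r0).
have -> : A1 * r + `|w| * r * (2 ^+ m * (B * (1 * K ^+ m))) = (A1 + S) * r.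
  by rewrite /S; ring.
by rewrite ler_wpM2r ?(ltW r0)// le_max lexx orbT.
Qed.

End Oscillation.

(** * Support of a local form that is isotypic under a reflection *)

Section InvariantForm.
Variables (R : realType) (N : nat) (i : 'I_N).
Local Notation SX := (schwartz R N).
Variables (D : SX -> SX -> R[i]) (U V : SX -> SX) (lambda : R[i]).
Implicit Types (f phi : SX) (x y : 'cV[R]_N).
Hypothesis D_tempered_l : forall phi, tempered (D^~ phi).
Hypothesis D_tempered_r : forall f, tempered (D f).
Hypothesis D_local : forall f phi a b, a < b ->
  (forall x, a < x i ord0 -> f x = 0) -> (forall x, x i ord0 < b -> phi x = 0) ->
  D f phi = 0.
Hypothesis U_slab : forall f L a y,
  (forall x, (x i ord0 < L) || (a < x i ord0) -> f x = 0) ->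
  (- y i ord0 < L) || (a < - y i ord0) -> U f y = 0.
Hypothesis V_slab : forall f L a y,
  (forall x, (x i ord0 < L) || (a < x i ord0) -> f x = 0) ->
  (- y i ord0 < L) || (a < - y i ord0) -> V f y = 0.
Hypothesis lambda_neq0 : lambda != 0.
Hypothesis D_isotypic : forall f phi, D (U f) phi = lambda * D f phi.
Hypothesis D_invariant : forall f phi, D (U f) (V phi) = D f phi.

Lemma multiplier_split f (h : R -> R) : smooth_bounded h ->
  f = multiplier i (fun t => 1 - h t) f + multiplier i h f.
Proof.
move=> sh; have sh' : smooth_bounded (fun t => 1 - h t).
  by apply: sbB => //; exact: sb_cst.
apply: schwartzP => x; rewrite schwartzDE !multiplierE// -mulrDl -rmorphD.
by rewrite subrK mul1r.
Qed.

Lemma truncation_slab r f x : 0 < r -> (x i ord0 < - (2 / r)) || (2 / r < x i ord0) ->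
  truncation i r f x = 0.
Proof.
move=> r0 h; rewrite truncationE cutoff0 ?mul0r//.
rewrite normrM (gtr0_norm r0) mulrC -ler_pdivrMr// ler_normr.
by case/orP: h => h; apply/orP; [right|left]; lra.
Qed.

(** Cut [f] around [x_i = 0]. The left part is separated from [phi]; the right part becomes so after
    applying [U], which only multiplies the form by [lambda]. The initial truncation supplies the
    bounded slab that [U_slab] asks for. *)
Lemma vanish_right f phi d : 0 < d -> (forall x, x i ord0 < d -> phi x = 0) ->
  D f phi = 0.
Proof.
move=> d0 p0; apply: (tempered_truncation (D_tempered_l phi) (j := i)).
move=> r /andP[r0 _]; set g := truncation i r f.
pose h (t : R) : R := step (d^-1 * t + 2^-1).
have sh : smooth_bounded h by apply: sb_affine; exact: sb_step.
have sh' : smooth_bounded (fun t => 1 - h t) by apply: sbB => //; exact: sb_cst.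
have dV : d^-1 * d = 1 by rewrite mulVf// gt_eqF.
have dV0 : 0 < d^-1 by rewrite invr_gt0.
have h0 t : t <= - (d / 2) -> h t = 0.
  move=> td; rewrite /h step0//.
  have : 0 <= d^-1 * (- (d / 2) - t) by rewrite mulr_ge0 ?(ltW dV0)// subr_ge0.
  by rewrite mulrBr mulrN mulrA dV; lra.
have h1 t : d / 2 <= t -> h t = 1.
  move=> td; rewrite /h step1//.
  have : 0 <= d^-1 * (t - d / 2) by rewrite mulr_ge0 ?(ltW dV0)// subr_ge0.
  by rewrite mulrBr mulrA dV; lra.
have gs x : (x i ord0 < - (2 / r)) || (2 / r < x i ord0) -> g x = 0.
  exact: truncation_slab.
clearbody g; rewrite (multiplier_split g sh).
rewrite (scalar_add (u := D^~ phi)); last by case: (D_tempered_l phi).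
have dd : d / 2 < d by lra.
rewrite (D_local dd _ p0) ?add0r; last first.
  by move=> x hx; rewrite multiplierE// h1 ?(ltW hx)// subrr mul0r.
apply: (mulfI lambda_neq0); rewrite mulr0 -D_isotypic.
apply: (D_local dd _ p0) => x hx.
apply: (@U_slab _ (- (d / 2)) (2 / r)) => [y /orP[hy|hy]|]; last first.
- by apply/orP; left; rewrite ltrN2.
- by rewrite multiplierE// gs ?mulr0// hy orbT.
by rewrite multiplierE// h0 ?mul0r// ltW.
Qed.

(** Applying [U] and [V] together leaves the form unchanged and reflects [phi] into the right
    half-space, where [vanish_right] applies. *)
Lemma vanish_left f phi d : 0 < d -> (forall x, - d < x i ord0 -> phi x = 0) ->
  D f phi = 0.
Proof.
move=> d0 p0; apply: (tempered_truncation (D_tempered_r f) (j := i)).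
move=> r /andP[r0 _]; rewrite -D_invariant.
apply: (vanish_right _ d0) => x hx.
apply: (@V_slab _ (- (2 / r)) (- d)) => [y /orP[hy|hy]|].
- by rewrite truncation_slab ?hy.
- by rewrite truncationE p0// mulr0.
by apply/orP; right; rewrite ltrN2.
Qed.

Lemma vanish_off_hyperplane f phi d : 0 < d ->
  (forall x, `|x i ord0| < d -> phi x = 0) -> D f phi = 0.
Proof.
move=> d0 p0; have [sD _] := D_tempered_r f.
pose h (t : R) : R := step (d^-1 * t + 0).
have sh : smooth_bounded h by apply: sb_affine; exact: sb_step.
have sh' : smooth_bounded (fun t => 1 - h t) by apply: sbB => //; exact: sb_cst.
rewrite (multiplier_split phi sh).
rewrite scalar_add// (@vanish_left _ _ d)// ?add0r; last first.
  move=> x hx; rewrite multiplierE//; have [h1|h1] := ltP (x i ord0) d.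
    by rewrite p0 ?mulr0// ltr_norml hx.
  by rewrite /h step1 ?subrr ?mul0r// addr0 mulrC ler_pdivlMr// mul1r.
apply: (vanish_right _ d0) => x hx; rewrite multiplierE//.
have [h1|h1] := leP (x i ord0) 0.
  by rewrite /h step0 ?mul0r// addr0 mulr_ge0_le0// invr_ge0 ltW.
by rewrite p0 ?mulr0// ltr_norml hx andbT (lt_trans _ h1)// oppr_lt0.
Qed.

(* A distribution of order m supported on the hyperplane x_i = 0 is killed by
   the functions vanishing there to order m + 1. *)
Lemma finite_order f : exists M, forall (w : R) phi,
  D f (multiplier i (fun t => (1 - cos (w * t + 0)) ^+ M) phi) = 0.
Proof.
have [sD [k [m [C DC]]]] := D_tempered_r f; exists m.+1 => w phi.
have sb : smooth_bounded (bump (-1) 1 1 : R -> R) by exact: sb_bump.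
have b0 (y : R) : 2 < `|y| -> bump (-1) 1 1 y = 0.
  rewrite ltr_normr => h; apply: bump0 => //.
  by case/orP: h => h; apply/orP; [right|left]; lra.
have [A HA] := bC_one_minus_cos w m sb b0.
pose B : R := (2 ^+ m * A) ^+ m.+1.
apply: (@small_eq0 _ _ (`|C| * (2 ^+ m * (B * sn k m phi)))) => r /[dup] r01 /andP[r0 r1].
pose G (y : R) : R := bump (-1) 1 1 y * (1 - cos (w * r * y + 0)).
(* [q] is the multiplier [(1 - cos (w t)) ^ (m + 1)] cut off to [|t| <= 2 r]. *)
pose q (t : R) : R := G (r^-1 * t + 0) ^+ m.+1.
have sG : smooth_bounded G.
  apply: sbM => //; apply: sbB; first exact: sb_cst.
  by apply: sb_affine; exact: sb_cos.
have sq : smooth_bounded q by apply: sbX; exact: sb_affine.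
have sp : smooth_bounded (fun t : R => (1 - cos (w * t + 0)) ^+ m.+1).
  apply: sbX; apply: sbB; first exact: sb_cst.
  by apply: sb_affine; exact: sb_cos.
have rV : 1 <= r^-1 by rewrite invf_ge1.
(* The power contributes [r ^ (m + 1)] and rescaling by [1 / r] costs [r ^ (- m)], leaving one
   factor [r]; this dictates the exponent [m.+1]. *)
have bq : bC m (B * r) q.
  have rV' : `|r^-1| <= r^-1 by rewrite ger0_norm// invr_ge0 ltW.
  apply: bC_le (bC_affine 0 rV rV' (bC_exp m.+1 (HA r r01))).
  rewrite /B mulrA exprMn -mulrA [r ^+ m.+1]exprS -mulrA -exprMn divff ?gt_eqF//.
  by rewrite expr1n mulr1.
(* The two multipliers agree for [|x_i| < r], and [D f] ignores functions vanishing near the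
   hyperplane. *)
have -> : D f (multiplier i (fun t => (1 - cos (w * t + 0)) ^+ m.+1) phi) =
    D f (multiplier i q phi).
  apply/eqP; rewrite -subr_eq0 -scalar_sub//; apply/eqP.
  apply: (vanish_off_hyperplane f r0) => x hx.
  rewrite schwartzBE !multiplierE// -mulrBl /q /G.
  have -> : w * r * (r^-1 * x i ord0 + 0) + 0 = w * x i ord0 + 0.
    by rewrite !addr0 mulrA mulfK// gt_eqF.
  rewrite bump1 ?mul1r ?subrr ?mul0r// addr0 -ler_norml normrM.
  by rewrite ger0_norm ?invr_ge0 ?(ltW r0)// mulrC ler_pdivrMr// mul1r ltW.
apply: le_trans (DC _) _.
apply: (@le_trans _ _ (`|C| * sn k m (multiplier i q phi))).
  by rewrite ler_wpM2r ?sn_ge0// ler_norm.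
rewrite mulrCA ler_wpM2l//; apply: le_trans (sn_multiplier i phi k sq bq) _.
by rewrite le_eqVlt; apply/orP; left; apply/eqP; ring.
Qed.

End InvariantForm.

(** * From modulations to translations *)

Section Translation.
Variables (R : realType) (N : nat) (i : 'I_N).
Local Notation SX := (schwartz R N).
Variables (D : SX -> SX -> R[i]) (U V : SX -> SX) (u : 'cV[R]_N).
Implicit Types (f phi psi : SX) (x y : 'cV[R]_N).
Hypothesis D_tempered_r : forall f, tempered (D f).
Hypothesis D_right : forall f phi d, 0 < d ->
  (forall x, x i ord0 < d -> phi x = 0) -> D f phi = 0.
Hypothesis D_finite_order : forall f, exists M, forall (w : R) phi,
  D f (multiplier i (fun t => (1 - cos (w * t + 0)) ^+ M) phi) = 0.
Hypothesis U_surj : forall g, exists f, U f = g.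
Hypothesis V_surj : forall psi, exists phi, V phi = psi.
Hypothesis V_sub : forall phi psi, V (phi - psi) = V phi - V psi.
Hypothesis V_modulation : forall t phi x,
  V (modulation i t phi) x = V phi (x - t *: u).
Hypothesis u_gt0 : 0 < u i ord0.
Hypothesis D_invariant : forall f phi, D (U f) (V phi) = D f phi.

(** [V] conjugates this operator to the difference operator [psi (x - t u) - psi x]. *)
Let delta t phi : SX := modulation i t phi - phi.

Lemma iter_modulationE M t phi x :
  iter M (modulation i t) phi x = chi (t * x i ord0) ^+ M * phi x.
Proof.
elim: M => [|M IH]; first by rewrite expr0 mul1r.
by rewrite iterS modulationE IH exprS mulrA.
Qed.

Lemma iter_deltaE M t phi x :
  iter M (delta t) phi x = (chi (t * x i ord0) - 1) ^+ M * phi x.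
Proof.
elim: M => [|M IH]; first by rewrite expr0 mul1r.
by rewrite iterS /delta schwartzBE modulationE IH exprS -mulrA mulrBl mul1r.
Qed.

(** The square of the symbol of [delta] is divisible by [1 - cos], so [2 M] differences produce the
    power [M] of [D_finite_order]. *)
Lemma chi_sub1_sqr (a : R) :
  (chi a - 1) ^+ 2 = - 2 * chi a * (1 - cos (2 * pi * a))%:C.
Proof.
have h := chi_cos a; have h1 := chi_mulN a.
have -> : (1 - cos (2 * pi * a))%:C = 1 - (cos (2 * pi * a))%:C :> R[i].
  by rewrite rmorphB rmorph1.
move: (chi a) (chi (- a)) (cos (2 * pi * a))%:C h h1 => c c' C h h1.
transitivity (c * (2 * C) - 2 * c); last by ring.
by rewrite -h mulrDr (mulrC c c') h1; ring.
Qed.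

Lemma vanish_of_translation f phi : D f phi = 0.
Proof.
apply: (tempered_truncation (D_tempered_r f) (j := i)) => r /andP[r0 _].
set psi := truncation i r phi.
have psi0 x : (x i ord0 < - (2 / r)) || (2 / r < x i ord0) -> psi x = 0.
  exact: truncation_slab.
clearbody psi; have [f' <-] := U_surj f; have [rho Vrho] := V_surj psi.
have [M HM] := D_finite_order f'.
(* Since [t u_i = 2 B + 1], any [x] with [x_i < B + 1] has [x - t u] to the left of the slab
   carrying [psi]. *)
pose B := 2 / r; pose t := (2 * B + 1) / u i ord0.
have B0 : 0 < B by rewrite divr_gt0.
have tu : t * u i ord0 = 2 * B + 1 by rewrite divfK// gt_eqF.
(* On this half-space the translated term vanishes, so each difference only changes the sign. *)
have step n x : x i ord0 < B + 1 ->
    V (iter n (delta t) rho) x = (-1) ^+ n * psi x.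
  elim: n x => [|n IH] x hx; first by rewrite /= Vrho expr0 mul1r.
  rewrite iterS /delta V_sub schwartzBE V_modulation.
  have hx' : (x - t *: u) i ord0 < - B by rewrite !mxE tu; lra.
  rewrite !IH//; last by apply: lt_trans hx' _; lra.
  by rewrite psi0 ?hx'// mulr0 sub0r exprS mulN1r mulNr.
have E0 : D f' (iter (2 * M) (delta t) rho) = 0.
  rewrite -[RHS](HM (2 * pi * t) ((- 2) ^+ M *: iter M (modulation i t) rho)).
  congr (D f' _); apply: schwartzP => x.
  rewrite multiplierE; last first.
    apply: sbX; apply: sbB; first exact: sb_cst.
    by apply: sb_affine; exact: sb_cos.
  rewrite schwartzZE iter_deltaE iter_modulationE exprM chi_sub1_sqr.
  rewrite addr0 -(mulrA (2 * pi)) !exprMn rmorphXn; ring.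
rewrite -D_invariant in E0.
have [sD _] := D_tempered_r (U f').
(* An even number of differences gives back [psi] for [x_i < B + 1]; the remainder lives in the
   right half-space and is killed by [D_right]. *)
have : D (U f') (V (iter (2 * M) (delta t) rho) - psi) = 0.
  apply: (@D_right _ _ (B + 1)); first by rewrite addr_gt0.
  by move=> x hx; rewrite schwartzBE step// exprM sqrrN expr1n expr1n mul1r subrr.
by rewrite scalar_sub// E0 sub0r => /eqP; rewrite oppr_eq0 => /eqP.
Qed.

End Translation.

(** * The metaplectic group and Schur's lemma *)

Section MetaplecticCommutation.
Variables (R : realType) (N : nat) (Mp : set (mpelt R N)).
Hypothesis hMp : metaplectic_group Mp.

Lemma mpM_assoc (p q r : mpelt R N) : mpM (mpM p q) r = mpM p (mpM q r).
Proof. by rewrite /mpM /= mulmxA. Qed.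

(** With [r] the inverse of [q p], the element [p q r] lies over the identity, hence is one of the
    two elements [1] and [-1] of the kernel. *)
Lemma mp_commute_up_to_sign (p q : mpelt R N) : Mp p -> Mp q ->
  p.1 *m q.1 = q.1 *m p.1 ->
  (forall f, p.2 (q.2 f) = q.2 (p.2 f)) \/ (forall f, p.2 (q.2 f) = - q.2 (p.2 f)).
Proof.
case: hMp => _ [_ hM] hV _ h1 Mpp Mpq pq.
have [r [Mpr qpr rqp]] := hV _ (hM _ _ Mpq Mpp).
have c1 : (mpM (mpM p q) r).1 = 1%:M.
  by rewrite /= pq; have := congr1 fst qpr.
have E : mpM (mpM (mpM p q) r) (mpM q p) = mpM p q.
  by rewrite mpM_assoc rqp /mpM /= mulmx1.
have [cE|cE] := (h1 _).1 (conj (hM _ _ (hM _ _ Mpp Mpq) Mpr) c1).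
  left=> f; have /(congr1 (fun t : mpelt R N => t.2 f)) := E.
  by rewrite cE /= => <-.
right=> f; have /(congr1 (fun t : mpelt R N => t.2 f)) := E.
by rewrite cE /= => <-.
Qed.

(** The possible sign appears twice and cancels. *)
Lemma mp_sqr_commute (j q : mpelt R N) : Mp j -> Mp q ->
  j.1 *m q.1 = q.1 *m j.1 -> mpM (mpM j j) q = mpM q (mpM j j).
Proof.
move=> Mj Mq jq; have [hI _ _ _ _] := hMp.
have [_ lj _ _ _] := hI _ Mj.
rewrite /mpM /=; congr pair; first by rewrite -mulmxA jq !mulmxA jq.
apply/funext => f /=.
have [C|C] := mp_commute_up_to_sign Mj Mq jq; first by rewrite !C.
by rewrite !C -scaleN1r (linear_scale lj) C scaleN1r opprK.
Qed.

End MetaplecticCommutation.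

Section ComplexNorm.
Variable R : realType.

Lemma norm_cabs (z : R[i]) : `|z| = (cabs z)%:C.
Proof. by rewrite normc_def; case: z. Qed.

Lemma sum_sn_bound (n : nat) (I : Type) (s : seq I) (F : I -> schwartz R n -> R[i]) :
  (forall c, exists k m C, forall f, F c f <= (C * sn k m f)%:C) ->
  exists k m C, forall f, \sum_(c <- s) F c f <= (C * sn k m f)%:C.
Proof.
move=> H; elim: s => [|c s [k [m [C hC]]]].
  by exists 0%N, 0%N, 0 => f; rewrite big_nil mul0r.
have [k' [m' [C' hC']]] := H c.
exists (maxn k k'), (maxn m m'), (`|C| + `|C'|) => f; rewrite big_cons.
apply: le_trans (lerD (hC' f) (hC f)) _; rewrite -rmorphD lecR mulrDl addrC.
apply: lerD.
  apply: (@le_trans _ _ (`|C| * sn k m f)).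
    by rewrite ler_wpM2r ?sn_ge0// ler_norm.
  by rewrite ler_wpM2l// sn_mono ?leq_maxl.
apply: (@le_trans _ _ (`|C'| * sn k' m' f)).
  by rewrite ler_wpM2r ?sn_ge0// ler_norm.
by rewrite ler_wpM2l// sn_mono ?leq_maxr.
Qed.

End ComplexNorm.

(** An eigenspace of [Pi p] is closed, non-zero and, as [p] commutes with [K], invariant; hence it
    is everything. The inverse [r] excludes the eigenvalue [0]. *)
Lemma schur_central_scalar (R : realType) (N : nat) (K : set (mpelt R N)) (d : nat)
  (Pi : mpelt R N -> 'M[R[i]]_d) (p r : mpelt R N) :
  representation K (fun p (v : 'cV[R[i]]_d) => Pi p *m v) ->
  irreducible_rep K (fun p (v : 'cV[R[i]]_d) => Pi p *m v) ->
  K p -> (forall q, K q -> mpM p q = mpM q p) ->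
  K r -> mpM p r = mp1 R N ->
  exists2 lambda : R[i], lambda != 0 & Pi p = lambda%:M.
Proof.
move=> [hlin h1 hM _] [[v0 v00] hirr] Kp pc Kr pr.
have d0 : (0 < d)%N.
  rewrite lt0n; apply/eqP => d0; move/eqP: v00; apply; subst d.
  by rewrite flatmx0.
(* Eigenvectors are row vectors in [eigenvalueP], hence the transpose. *)
have [lambda /eigenvalueP[w wE w0]] := eigenvalue_closed (Pi p)^T d0.
have hMv q q' (v : 'cV[R[i]]_d) : K q -> K q' ->
    Pi (mpM q q') *m v = Pi q *m (Pi q' *m v).
  by move=> Kq Kq'; have := congr1 (fun F => F v) (hM q q' Kq Kq').
pose E : normedModType R[i] := 'cV[R[i]]_d.
pose A : set E := [set v : 'cV[R[i]]_d | Pi p *m v = lambda *: v].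
have A0 : A 0 by rewrite /A /= mulmx0 scaler0.
have cA : closed A.
  have -> : A = (fun v : E => (Pi p *m v : E) - lambda *: v) @^-1` [set 0].
    apply/seteqP; split=> v /=; first by move=> ->; rewrite subrr.
    by move/eqP; rewrite subr_eq0 => /eqP.
  apply: preimage_closed; last first.
    apply: accessible_closed_set1; apply: hausdorff_accessible.
    exact: norm_hausdorff.
  have c1 : continuous (fun v : E => Pi p *m v : E) by exact: (hlin p Kp).2.
  have c2 : continuous (fun v : E => lambda *: v) by exact: scaler_continuous.
  by move=> v _; exact: continuousB (c1 v) (c2 v).
have lA (a : R[i]) u v : A u -> A v -> A (a *: u + v).
  move=> hu hv; rewrite /A /= mulmxDr -scalemxAr hu hv scalerDr !scalerA.
  by rewrite mulrC.
have KA q v : K q -> A v -> A (Pi q *m v).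
  move=> Kq hv; rewrite /A /= -hMv// pc// hMv// hv.
  by rewrite scalemxAr.
have Aw : A w^T by rewrite /A /= -[Pi p]trmxK -trmx_mul wE linearZ.
have {}hirr : A = setT.
  case: (hirr A cA A0 lA KA) => // A_eq0; move: Aw; rewrite A_eq0 /= => /eqP.
  by rewrite trmx_eq0 (negbTE w0).
have pE (v : 'cV[R[i]]_d) : Pi p *m v = lambda *: v.
  by have : A v by rewrite hirr.
have PiE : Pi p = lambda%:M.
  apply/matrixP => a b.
  have := congr1 (fun M : 'cV_d => M a ord0) (pE (delta_mx b ord0)).
  rewrite -colE !mxE => ->.
  by rewrite eqxx andbT mulr_natr.
exists lambda => //; apply/eqP => l0; move/eqP: v00; apply.
have := hMv p r v0 Kp Kr; rewrite pr.
have -> : Pi (mp1 R N) *m v0 = v0 by have := congr1 (fun F => F v0) h1.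
by rewrite pE l0 scale0r.
Qed.

Lemma sconjE (R : realType) (N : nat) (f : schwartz R N) x : sconj f x = (f x)^*.
Proof. by []. Qed.

Lemma sconjK (R : realType) (N : nat) (f : schwartz R N) : sconj (sconj f) = f.
Proof. by apply: schwartzP => x; rewrite !sconjE conjcK. Qed.

Lemma sconj_sub (R : realType) (N : nat) (f g : schwartz R N) :
  sconj (f - g) = sconj f - sconj g.
Proof. by apply: schwartzP => x; rewrite sconjE !schwartzBE rmorphB. Qed.

Lemma sconj_modulation (R : realType) (N : nat) i t (f : schwartz R N) :
  sconj (modulation i t f) = modulation i (- t) (sconj f).
Proof.
apply: schwartzP => x; rewrite sconjE !modulationE sconjE mulNr -chi_conj.
exact: (rmorphM (@conjc R)).
Qed.

Lemma SpN1 (R : realType) (N : nat) : Sp (- 1%:M : 'M[R]_(N + N)).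
Proof.
move=> w w'; rewrite /sform !mulNmx !mul1mx.
have -> : (- w)^T = - w^T by rewrite linearN.
by rewrite !mulNmx mulmxN opprK.
Qed.

(** * Non-locality of the symmetry breaking operator *)

Theorem corollary14 (R : realType) (N : nat)
  (Mp : set (mpelt R N)) (G G' : set 'M[R]_(N + N)) (J : 'M[R]_(N + N))
  (hMp : metaplectic_group Mp)
  (hGG' : irreducible_dual_pair G G')
  (hG : compact G)
  (hJ : compatible_structure G G' J)
  (d : nat) (Pi : mpelt R N -> 'M[R[i]]_d)
  (hPi : representation (mp_preimage Mp G)
           (fun p (v : 'cV[R[i]]_d) => Pi p *m v))
  (hPi_irr : irreducible_rep (mp_preimage Mp G)
           (fun p (v : 'cV[R[i]]_d) => Pi p *m v))
  (H : completeNormedModType R[i]) (hH : hilbert_norm H)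
  (Pi' : mpelt R N -> H -> H)
  (hPi' : representation (mp_preimage Mp G') Pi')
  (hPi'_irr : irreducible_rep (mp_preimage Mp G') Pi')
  (hocc : occurs_in_Howe (mp_preimage Mp G) (mp_preimage Mp G') Pi Pi')
  (iota : ('I_d -> H) -> schwartz R N -> R[i])
  (hiota : realization (mp_preimage Mp G) (mp_preimage Mp G') Pi Pi' iota)
  (T : schwartz R N -> 'I_d -> H)
  (hT : intertwining (mp_preimage Mp G) (mp_preimage Mp G') Pi Pi' T)
  (hT0 : exists f, T f <> 0) :
  ~ differential_operator (fun f phi => iota (T f) phi).
Proof.
set D := fun f phi => iota (T f) phi => D_diff.
have [N0 G'E GE _ _] := hGG'; pose i : 'I_N := Ordinal N0.
have [_ JJ Jpos [JG G'J] JX] := hJ.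
have [hI [M1 hM] hV hsurj _] := hMp.
have SpJ : Sp J by move: G'J; rewrite G'E => -[].
have [[J' Uj] Mj /= J'E] := hsurj J SpJ; subst J'.
set j : mpelt R N := (J, Uj) in Mj.
have [_ Uj_lin Uj_bij _ _] := hI _ Mj; rewrite /= in Uj_lin Uj_bij.
have [[iota_temp iota_lin iota_inj] iota_cont _ iota_G'] := hiota.
have [T_lin T_smooth T_cont T_G T_G'] := hT.
(* While [j] lies over [G'], its square lies over [J ^ 2 = - 1], which also belongs to [G], a
   centralizer in [Sp]. Thus Schur's lemma for [Pi] applies to [p]. *)
pose p : mpelt R N := mpM j j.
have Mpp : Mp p by exact: hM.
have p1 : p.1 = - 1%:M by rewrite /= JJ.
have GN1 : G (- 1%:M).
  rewrite GE; split; first exact: SpN1.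
  by move=> h _; rewrite mulNmx mul1mx mulmxN mulmx1.
have Gp : mp_preimage Mp G p by split=> //; rewrite p1.
have [r [Mpr pr rp]] := hV _ Mpp.
have Gr : mp_preimage Mp G r.
  split=> //; suff -> : r.1 = - 1%:M by [].
  have : p.1 *m r.1 = 1%:M := congr1 fst pr.
  rewrite p1 mulNmx mul1mx => /(congr1 -%R).
  by rewrite opprK.
have pcomm q : mp_preimage Mp G q -> mpM p q = mpM q p.
  by move=> [Mq Gq]; apply: (mp_sqr_commute hMp Mj Mq); exact: JG.
have [lambda l0 PiE] := schur_central_scalar hPi hPi_irr Gp pcomm Gr pr.
have D_isotypic f phi : D (p.2 f) phi = lambda * D f phi.
  rewrite /D T_G//.
  have -> : act1 Pi p (T f) = (lambda - 1) *: T f + T f.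
    apply/funext => a; rewrite /act1 PiE (bigD1 a)//= mxE eqxx big1 ?addr0.
      by rewrite mulr1n !fctE scalerBl scale1r subrK.
    by move=> b ba; rewrite mxE eq_sym (negbTE ba) scale0r.
  by rewrite iota_lin//; ring.
(* The action of [j] on test functions for which [iota] is invariant: [Uj] conjugated by complex
   conjugation. *)
pose Vj phi : schwartz R N := sconj (Uj (sconj phi)).
have D_inv f phi : D (Uj f) (Vj phi) = D f phi.
  have Gj : mp_preimage Mp G' j by split.
  by rewrite /D (T_G' j f Gj) /Vj (iota_G' j (T f) phi Gj).
have D_temp_r f : tempered (D f) by exact: iota_temp.
(* Continuity in [f] composes the bound of [iota] by finitely many seminorms of smooth vectors with
   the continuity of [T] for each of them. *)
have D_temp_l phi : tempered (D^~ phi).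
  split=> [a f g|]; first by rewrite /D T_lin iota_lin.
  have [L [C hC]] := iota_cont phi.
  have [k [m [B hB]]] : exists k m B, forall f,
      \sum_(cs <- L) \sum_a `|dpis Pi' cs (T f a)| <= (B * sn k m f)%:C.
    apply: (@sum_sn_bound R N _ L (fun cs f => \sum_a `|dpis Pi' cs (T f a)|)) => cs.
    apply: (@sum_sn_bound R N _ (index_enum _)
      (fun a f => `|dpis Pi' cs (T f a)|)) => a; exact: T_cont.
  exists k, m, (`|C| * B) => f; rewrite -lecR -norm_cabs.
  apply: le_trans (hC _ (T_smooth f)) _; rewrite -mulrA rmorphM /=.
  apply: (@le_trans _ _ (`|C|%:C * \sum_(cs <- L) \sum_a `|dpis Pi' cs (T f a)|)).
    by rewrite ler_wpM2r ?lecR ?ler_norm// sumr_ge0// => cs _; exact: sumr_ge0.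
  by rewrite ler_wpM2l// lecR.
(* An operator over [- 1] inverts every modulation, so it reflects slabs. *)
have U_slab (f : schwartz R N) (L a : R) (y : 'cV[R]_N) :
    (forall x : 'cV[R]_N, (x i ord0 < L) || (a < x i ord0) -> f x = 0) ->
    (- y i ord0 < L) || (a < - y i ord0) -> p.2 f y = 0.
  apply: reflection_slab.
    by case: (hI _ Mpp).
  move=> t g x; rewrite (implements_modulation i t g x (hI _ Mpp)).
  rewrite p1 mulNmx mul1mx /inY opp_col_mx oppr0 -scaleNr -/(inY _) heis_inY.
  by rewrite mulNr.
(* The counterpart of [p] on test functions, which therefore reflects slabs as well. *)
pose V phi := Vj (Vj phi).
have VE phi : V phi = sconj (p.2 (sconj phi)) by rewrite /V /Vj sconjK.
have V_slab (f : schwartz R N) (L a : R) (y : 'cV[R]_N) :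
    (forall x : 'cV[R]_N, (x i ord0 < L) || (a < x i ord0) -> f x = 0) ->
    (- y i ord0 < L) || (a < - y i ord0) -> V f y = 0.
  move=> hf hy; rewrite VE sconjE (U_slab _ L a) ?conjc0// => x /hf.
  by rewrite sconjE => ->; rewrite conjc0.
have D_inv2 f phi : D (p.2 f) (V phi) = D f phi by rewrite /V !D_inv.
have D_loc f phi (a b : R) := @local_halfspace R N D D_temp_l D_temp_r D_diff f phi i a b.
have D_right := @vanish_right R N i D p.2 lambda D_temp_l D_loc U_slab l0 D_isotypic.
have D_fin := @finite_order R N i D p.2 V lambda D_temp_l D_temp_r D_loc U_slab V_slab
  l0 D_isotypic D_inv2.
(* From [J X = Y] and [J ^ 2 = - 1] it follows that [J Y = X]: if [J x] is the basis vector, then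
   [u = - x]. *)
have [u uE] : exists u : 'cV[R]_N, J *m inY (delta_mx i ord0 : 'cV[R]_N) = inX u.
  have : range (@inY R N) (inY (delta_mx i ord0 : 'cV[R]_N)) by exists (delta_mx i ord0).
  rewrite -JX => -[_ [x _ <-] <-]; exists (- x).
  by rewrite mulmxA JJ mulNmx mul1mx /inX opp_col_mx oppr0.
(* With [e_i] in [Y], the coordinate [u_i] equals [<J e_i, e_i>], which is positive. *)
have u0 : 0 < u i ord0.
  have := Jpos (inY (delta_mx i ord0)); rewrite uE sform_inX_inY dot_delta; apply.
  apply/eqP => /(congr1 (fun z : 'cV[R]_(N + N) => z (rshift N i) ord0)).
  rewrite /inY col_mxEd !mxE !eqxx => /eqP; by rewrite oner_eq0.
(* Complex conjugation turns [t] into [- t], the modulation attached to [t e_i] in [Y], which [Uj]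
   carries to the translation by [J (t e_i) = t u]. *)
have Vj_mod t phi x : Vj (modulation i t phi) x = Vj phi (x - t *: u).
  rewrite /Vj !sconjE sconj_modulation.
  rewrite (implements_modulation i (- t) (sconj phi) (x : 'cV[R]_N) (hI _ Mj)).
  have -> : j.1 *m inY (- - t *: delta_mx i ord0) = inX (t *: u).
    rewrite opprK /= -[inY _](_ : t *: inY (delta_mx i ord0) = _).
      by rewrite -scalemxAr uE /inX scale_col_mx scaler0.
    by rewrite /inY scale_col_mx scaler0.
  by rewrite heis_inX.
have [Ui UiK UKi] := Uj_bij.
have Vj_sub phi psi : Vj (phi - psi) = Vj phi - Vj psi.
  by rewrite /Vj sconj_sub (linear_sub Uj_lin) sconj_sub.
have Vj_surj psi : exists phi, Vj phi = psi.
  by exists (sconj (Ui (sconj psi))); rewrite /Vj sconjK UKi sconjK.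
have Uj_surj g : exists f, Uj f = g by exists (Ui g).
have D0 := @vanish_of_translation R N i D Uj Vj u D_temp_r D_right D_fin Uj_surj
  Vj_surj Vj_sub Vj_mod u0 D_inv.
have [f fT] := hT0; apply: fT; apply: iota_inj => //.
by apply/funext => phi; exact: D0.
Qed.
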